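(* Let $a\in\mathbb{C}$. For $m\in\mathbb{N}_0=\{0,1,2,\dotsc\}$, the Gauss hypergeometric function ${}_2F_1$ has the explicit expression $$ {}_2F_1\Bigl(a,a+\frac{1}{2};\frac{3}{2}-m;z^2\Bigr) =\frac{1}{2(2a-1)}\frac{1}{(2m-3)!!}\sum_{k=0}^{m}(2m-2k-1)!!\binom{2m-k-1}{k-1}\bigl[(2a-1)_k(1+z)^{1-2a-k}-\langle1-2a\rangle_k(1-z)^{1-2a-k}\bigr]z^{k-1}. $$
   Context: The Gauss hypergeometric function is ${}_2F_1(a,b;c;x)=\sum_{j=0}^\infty\frac{(a)_j(b)_j}{(c)_j}\frac{x^j}{j!}$ for $a,b\in\mathbb{C}$ and $c\in\mathbb{C}\setminus\{0,-1,-2,\dotsc\}$. If $a$ or $b$ is a nonpositive integer, the series terminates and is a polynomial in $x$. Otherwise it converges for $|x|<1$, and the function is single-valued analytic on $\mathbb{C}\setminus[1,\infty)$. Rising factorial: $(x)_k=x(x+1)\dotsm(x+k-1)$ for $k\ge1$, $(x)_0=1$. Falling factorial: $\langle x\rangle_k=x(x-1)\dotsm(x-k+1)$ for $k\ge1$, $\langle x\rangle_0=1$. Double factorials: $(2r-1)!!=1\cdot3\dotsm(2r-1)$ for $r\ge1$, and $(-2r-1)!!=\frac{(-1)^r}{(2r-1)!!}$ for $r\in\mathbb{N}_0$, with $(-1)!!=1$; so $(-3)!!=-1$. Extended binomial coefficients: for integer $w\ge0$, $\binom{x}{w}=\frac{\langle x\rangle_w}{w!}$; for integer $w<0$ and $x$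 not a negative integer, $\binom{x}{w}=0$; and $\binom{-1}{-1}=1$. *)

(* Defs.v *)
From Stdlib Require Export Reals ZArith ClassicalEpsilon.
From Coquelicot Require Export Coquelicot.
Open Scope R_scope.

Fixpoint rising (x : C) (k : nat) : C :=
  match k with
  | O => 1
  | S j => rising x j * (x + INR j)
  end%C.

Fixpoint falling (x : C) (k : nat) : C :=
  match k with
  | O => 1
  | S j => falling x j * (x - INR j)
  end%C.

(* 1 * 3 * ... * (2r - 1) *)
Fixpoint odd_product (r : nat) : R :=
  match r with
  | O => 1
  | S s => odd_product s * INR (2 * s + 1)
  end.

(* n!! for odd n of either sign: for n = 2r - 1 >= -1 it is odd_product r, and
   for n = -2r - 1 < -1 it is (-1)^r / (2r - 1)!!.  Values at even n are
   meaningless. *)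
Definition odd_dfact (n : Z) : R :=
  if (-1 <=? n)%Z then odd_product (Z.to_nat ((n + 1) / 2))
  else let r := Z.to_nat ((- n - 1) / 2) in (-1) ^ r / odd_product r.

(* The binomial coefficient is left undefined when w < 0 and x is a negative
   integer other than x = w = -1; here it is 0 in that case. *)
Definition binomial (x : C) (w : Z) : C :=
  if (0 <=? w)%Z then (falling x (Z.to_nat w) / INR (fact (Z.to_nat w)))%C
  else if (w =? -1)%Z then (if Ceq_dec x (-1)%R then 1 else 0)%C
  else 0%C.

Definition Czpow (z : C) (n : Z) : C :=
  match n with
  | Z0 => 1
  | Zpos p => z ^ Pos.to_nat p
  | Zneg p => / z ^ Pos.to_nat p
  end%C.

Definition Cexp (z : C) : C :=
  (exp (Re z) * cos (Im z), exp (Re z) * sin (Im z)).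

(* Principal argument, with values in (-PI, PI]. *)
Definition Carg (z : C) : R :=
  if Rlt_dec (Im z) 0 then - acos (Re z / Cmod z) else acos (Re z / Cmod z).

Definition Clog (z : C) : C := (ln (Cmod z), Carg z).

(* Principal value of z^s, with 0^0 = 1 and 0^s = 0 for s <> 0. *)
Definition Ccpow (z s : C) : C :=
  if Ceq_dec z 0 then (if Ceq_dec s 0 then 1 else 0)%C
  else Cexp (s * Clog z).

Definition analytic_at (F : C -> C) (x : C) : Prop :=
  exists (u : nat -> C) (r : R), 0 < r /\
    forall y : C, Cmod (y - x) < r ->
      @is_pseries C_AbsRing C_NormedModule u (y - x)%C (F y).

(* C \ [1, +oo) *)
Definition slit_plane (x : C) : Prop := ~ (Im x = 0 /\ 1 <= Re x).

Definition nonpos_int (a : C) : Prop := exists n : nat, a = (- INR n)%R.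

Definition hyp2F1_coef (a b c : C) (j : nat) : C :=
  (rising a j * rising b j / rising c j / INR (fact j))%C.

(* F is the Gauss function with parameters a, b, c: it is the sum of the
   hypergeometric series in the unit disc, and on all of C if the series
   terminates, and it is analytic on C \ [1, +oo).  For c not a nonpositive
   integer this determines F on the set hyp2F1_dom a b. *)
Definition is_hyp2F1 (a b c : C) (F : C -> C) : Prop :=
  (forall x : C, Cmod x < 1 \/ nonpos_int a \/ nonpos_int b ->
     @is_pseries C_AbsRing C_NormedModule (hyp2F1_coef a b c) x (F x)) /\
  (forall x : C, slit_plane x -> analytic_at F x).

Definition hyp2F1 (a b c : C) : C -> C :=
  epsilon (inhabits (fun _ : C => RtoC 0)) (is_hyp2F1 a b c).

Definition hyp2F1_dom (a b x : C) : Prop :=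
  slit_plane x \/ nonpos_int a \/ nonpos_int b.

(* Main.v *)
Require Import Defs.
From Stdlib Require Import Lra Lia Psatz Classical.

(* Put p = 1 - 2a.  Multiplying the closed form by z and expanding (1 + z)^(p-k)
   and (1 - z)^(p-k) in binomial series, the coefficient of z^N is
   <p>_N (1 - (-1)^N) / N! times a sum over k of C_(m,k) (-1)^k <N>_k, where C_(m,k)
   are, up to sign, the coefficients of the operator (1/z d/dz)^m; that operator maps
   z^N to N (N-2) ... (N-2m+2) z^(N-2m), so the sum is the product of the (2i - N),
   i < m, and the odd coefficients are those of the hypergeometric series in z^2.
   When p is a natural number the binomial series terminate and this holds for all z.

   The closed form is even in z, hence a function of x = z^2.  Off 0 it is a
   combination of functions (1 +- s)^p s^q with s a local square root of x; this
   family is stable under d/dx, which bounds all derivatives and makes the Taylor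
   series converge.  So the closed form is a Gauss function in the sense of
   [is_hyp2F1], and two such functions agree on the slit plane, which is star-shaped
   about 0, by the identity theorem along rays. *)

(** * Derivatives along paths in C *)

(** [hyp2F1] is chosen by [epsilon], so nothing is known about it until some function satisfies
    [is_hyp2F1]; the closed form serves as that witness as well as being the claimed value. No
    complex differentiability is used: derivatives are taken along real segments, and Taylor
    remainders are estimated by the mean value theorem on real and imaginary parts, at the price of
    a factor 2. The main obstacle is the square root of x: the principal one jumps across the
    negative axis, which lies inside the slit plane, so near each base point a branch adapted to
    that point is used, and evenness of the closed form makes the choice of root irrelevant. At 0
    there is no branch, but there the hypergeometric series is itself the required expansion.
    Terminating parameters are treated apart, since z^2 may then lie on the slit. *)

Lemma C_ext (x y : C) : Re x = Re y -> Im x = Im y -> x = y.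
Proof. destruct x, y; simpl; intros; subst; reflexivity. Qed.

Lemma Cmod_def (w : C) : Cmod w = sqrt (Re w ^ 2 + Im w ^ 2).
Proof. reflexivity. Qed.

Lemma Cmod_sqr (w : C) : Cmod w * Cmod w = Re w * Re w + Im w * Im w.
Proof. rewrite Cmod_def, sqrt_sqrt; nra. Qed.

(** Taken coordinatewise, so that the real calculus of [is_derive] and the real mean value theorem
    apply directly. *)
Definition path_derive (g : R -> C) (t : R) (l : C) : Prop :=
  is_derive (fun s => Re (g s)) t (Re l) /\
  is_derive (fun s => Im (g s)) t (Im l).

Lemma path_derive_eq g t l l' : path_derive g t l -> l = l' -> path_derive g t l'.
Proof. intros; subst; auto. Qed.

Lemma path_derive_ext_loc f g t l :
  locally t (fun s => f s = g s) -> path_derive f t l -> path_derive g t l.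
Proof.
  intros H [H1 H2]; split; (eapply is_derive_ext_loc; [|eassumption]);
    revert H; apply filter_imp; intros s ->; reflexivity.
Qed.

Lemma path_derive_ext f g t l :
  (forall s, f s = g s) -> path_derive f t l -> path_derive g t l.
Proof. intros H; apply path_derive_ext_loc; apply filter_forall, H. Qed.

Lemma path_derive_const (c : C) t : path_derive (fun _ => c) t 0.
Proof. split; simpl; auto_derive; auto. Qed.

Lemma path_derive_real (f : R -> R) t l :
  is_derive f t l -> path_derive (fun s => RtoC (f s)) t l.
Proof. intros H; split; simpl; auto. auto_derive; auto. Qed.

Lemma path_derive_plus f g t lf lg :
  path_derive f t lf -> path_derive g t lg ->
  path_derive (fun s => f s + g s)%C t (lf + lg)%C.
Proof. intros [H1 H2] [H3 H4]; split; apply @is_derive_plus; auto. Qed.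

Lemma is_derive_Rmult (f g : R -> R) t lf lg :
  is_derive f t lf -> is_derive g t lg ->
  is_derive (fun s => f s * g s) t (lf * g t + f t * lg).
Proof.
  intros Hf Hg. apply (is_derive_mult f g t lf lg); auto. intros; apply Rmult_comm.
Qed.

Lemma path_derive_mult f g t lf lg :
  path_derive f t lf -> path_derive g t lg ->
  path_derive (fun s => f s * g s)%C t (lf * g t + f t * lg)%C.
Proof.
  intros [H1 H2] [H3 H4]; split.
  - replace (Re (lf * g t + f t * lg)%C) with
      ((Re lf * Re (g t) + Re (f t) * Re lg) - (Im lf * Im (g t) + Im (f t) * Im lg))
      by (simpl; unfold Re, Im; simpl; ring).
    apply @is_derive_minus; apply is_derive_Rmult; auto.
  - replace (Im (lf * g t + f t * lg)%C) with
      ((Re lf * Im (g t) + Re (f t) * Im lg) + (Im lf * Re (g t) + Im (f t) * Re lg))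
      by (simpl; unfold Re, Im; simpl; ring).
    apply @is_derive_plus; apply is_derive_Rmult; auto.
Qed.

Lemma path_derive_scal (c : C) g t l :
  path_derive g t l -> path_derive (fun s => c * g s)%C t (c * l)%C.
Proof.
  intros H. eapply path_derive_eq; [apply path_derive_mult; [apply path_derive_const | exact H]|].
  simpl; ring.
Qed.

Lemma path_derive_line (x h : C) t : path_derive (fun s => x + s * h)%C t h.
Proof.
  eapply path_derive_eq.
  - apply path_derive_plus; [apply path_derive_const|].
    apply path_derive_mult; [|apply path_derive_const].
    apply (path_derive_real (fun s => s) t 1), @is_derive_id.
  - cbv beta; ring.
Qed.

Lemma path_derive_Cexp g t l :
  path_derive g t l -> path_derive (fun s => Cexp (g s)) t (l * Cexp (g t))%C.
Proof.
  intros [H1 H2]; split; unfold Cexp; simpl;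
    set (u := fun s => Re (g s)) in *; set (v := fun s => Im (g s)) in *.
  - eapply is_derive_ext with (f := fun s => exp (u s) * cos (v s)); [reflexivity|].
    evar_last.
    + apply is_derive_Rmult.
      * apply (is_derive_comp exp u); [apply is_derive_exp | exact H1].
      * apply (is_derive_comp cos v); [apply is_derive_cos | exact H2].
    + unfold u, v, scal, Re, Im; simpl; unfold mult; simpl. ring.
  - eapply is_derive_ext with (f := fun s => exp (u s) * sin (v s)); [reflexivity|].
    evar_last.
    + apply is_derive_Rmult.
      * apply (is_derive_comp exp u); [apply is_derive_exp | exact H1].
      * apply (is_derive_comp sin v); [apply is_derive_sin | exact H2].
    + unfold u, v, scal, Re, Im; simpl; unfold mult; simpl. ring.
Qed.

(* C \ (-oo, 0] *)
Definition cut_plane (w : C) : Prop := 0 < Cmod w + Re w.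

Lemma cut_plane_intro (w : C) : Im w <> 0 \/ 0 < Re w -> cut_plane w.
Proof.
  unfold cut_plane; intros H. pose proof (Cmod_sqr w). pose proof (Cmod_ge_0 w).
  destruct (Rlt_dec 0 (Re w)); [lra|].
  destruct H as [H|H]; [|lra].
  assert (0 < Im w * Im w) by nra. nra.
Qed.

Lemma cut_plane_neq_0 (w : C) : cut_plane w -> w <> 0%C.
Proof. intros H ->. unfold cut_plane in H. rewrite Cmod_0 in H. simpl in H; lra. Qed.

(** This is tan(th/2) = sin th / (1 + cos th). The piecewise [acos] in [Carg] cannot be
    differentiated on the positive axis, whereas the [atan] formula is smooth wherever its
    denominator is positive, that is on all of [cut_plane]. *)
Lemma Carg_half_angle (w : C) :
  cut_plane w -> Carg w = 2 * atan (Im w / (Cmod w + Re w)).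
Proof.
  intros Hw. pose proof (Cmod_sqr w) as Hq.
  assert (Hr : 0 < Cmod w) by (apply Cmod_gt_0, cut_plane_neq_0, Hw).
  unfold cut_plane in Hw.
  set (r := Cmod w) in *. set (u := Re w) in *. set (v := Im w) in *.
  assert (Hb : -1 <= u / r <= 1).
  { split; [apply Rmult_le_reg_r with r | apply Rmult_le_reg_r with r]; auto;
    unfold Rdiv; rewrite Rmult_assoc, Rinv_l by lra; nra. }
  set (th := acos (u / r)).
  assert (Hc : cos th = u / r) by (apply cos_acos, Hb).
  pose proof (acos_bound (u / r)) as Hth. fold th in Hth.
  assert (Hlt : th < PI).
  { destruct (Req_dec th PI) as [E|E]; [|lra].
    rewrite E, cos_PI in Hc. assert (u = - r) by (field_simplify_eq in Hc; lra). lra. }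
  assert (Hs : sin th = Rabs v / r).
  { unfold th. rewrite sin_acos by exact Hb.
    replace (1 - (u / r)²) with ((Rabs v / r)²).
    - apply sqrt_Rsqr. apply Rmult_le_pos; [apply Rabs_pos | left; apply Rinv_0_lt_compat, Hr].
    - rewrite !Rsqr_div'. rewrite <- Rsqr_abs. unfold Rsqr. field_simplify_eq; lra. }
  assert (Ht : tan (th / 2) = Rabs v / (r + u)).
  { assert (0 < cos (th / 2)) by (apply cos_gt_0; pose proof PI_RGT_0; lra).
    assert (E1 : cos th = 2 * cos (th/2) * cos (th/2) - 1).
    { replace th with (2 * (th / 2)) at 1 by field. apply cos_2a_cos. }
    assert (E2 : sin th = 2 * sin (th/2) * cos (th/2)).
    { replace th with (2 * (th / 2)) at 1 by field. apply sin_2a. }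
    assert (E3 : u = r * cos th) by (rewrite Hc; field; lra).
    assert (E4 : Rabs v = r * sin th) by (rewrite Hs; field; lra).
    rewrite E4, E3, E1, E2. unfold tan. field.
    assert (0 < cos (th / 2) * cos (th/2)) by nra.
    split; [|lra]. intros E.
    assert (r * (2 * (cos (th / 2) * cos (th/2))) = 0) by lra. nra. }
  assert (Ha : th = 2 * atan (Rabs v / (r + u))).
  { rewrite <- Ht, atan_tan; [field|]. lra. }
  unfold Carg. fold r u v th. destruct (Rlt_dec v 0) as [Hn|Hn].
  - rewrite Ha, Rabs_left by lra.
    replace (- v / (r + u)) with (- (v / (r + u))) by (field; lra).
    rewrite atan_opp. ring.
  - rewrite Ha, Rabs_right by lra. reflexivity.
Qed.

Lemma Cexp_plus (x y : C) : Cexp (x + y) = (Cexp x * Cexp y)%C.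
Proof.
  apply C_ext; unfold Cexp, Re, Im; simpl; rewrite exp_plus, ?cos_plus, ?sin_plus; ring.
Qed.

Lemma Cexp_0 : Cexp 0 = 1%C.
Proof. apply C_ext; simpl; rewrite exp_0, ?cos_0, ?sin_0; ring. Qed.

Lemma Cexp_neq_0 (x : C) : Cexp x <> 0%C.
Proof.
  intros H. pose proof (Cexp_plus x (- x)) as E.
  rewrite H, Cmult_0_l in E. replace (x + - x)%C with (RtoC 0) in E by ring.
  rewrite Cexp_0 in E. exact (C1_nz E).
Qed.

Lemma Cexp_opp (x : C) : Cexp (- x) = (/ Cexp x)%C.
Proof.
  pose proof (Cexp_plus x (- x)) as E. replace (x + - x)%C with (RtoC 0) in E by ring.
  rewrite Cexp_0 in E. pose proof (Cexp_neq_0 x) as H.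
  rewrite <- (Cmult_1_r (/ Cexp x)), E. field; exact H.
Qed.

Lemma Cmod_Cexp (x : C) : Cmod (Cexp x) = exp (Re x).
Proof.
  rewrite Cmod_def. unfold Cexp; simpl. pose proof (sin2_cos2 (Im x)) as H. unfold Rsqr in H.
  replace (_ + _) with (exp (Re x) * exp (Re x)).
  - apply sqrt_square. left; apply exp_pos.
  - transitivity (exp (Re x) * exp (Re x) * (sin (Im x) * sin (Im x) + cos (Im x) * cos (Im x))).
    + rewrite H; ring.
    + ring.
Qed.

Lemma Cexp_Clog (w : C) : w <> 0%C -> Cexp (Clog w) = w.
Proof.
  intros Hw. assert (Hr : 0 < Cmod w) by (apply Cmod_gt_0, Hw).
  pose proof (Cmod_sqr w) as Hq.
  set (r := Cmod w) in *.
  assert (Hb : -1 <= Re w / r <= 1).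
  { split; (apply Rmult_le_reg_r with r; auto;
    unfold Rdiv; rewrite Rmult_assoc, Rinv_l by lra; nra). }
  assert (Hs : sin (acos (Re w / r)) = Rabs (Im w) / r).
  { rewrite sin_acos by exact Hb.
    replace (1 - (Re w / r)²) with ((Rabs (Im w) / r)²).
    - apply sqrt_Rsqr. apply Rmult_le_pos; [apply Rabs_pos | left; apply Rinv_0_lt_compat, Hr].
    - rewrite !Rsqr_div'. rewrite <- Rsqr_abs. unfold Rsqr. field_simplify_eq; lra. }
  unfold Clog, Carg, Cexp. fold r. simpl.
  destruct (Rlt_dec (Im w) 0) as [Hn|Hn]; apply C_ext; simpl; rewrite exp_ln by exact Hr;
    rewrite ?cos_neg, ?sin_neg, ?Hs, ?cos_acos by exact Hb.
  - field; lra.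
  - rewrite Rabs_left by lra. field; lra.
  - field; lra.
  - rewrite Rabs_right by lra. field; lra.
Qed.

Lemma path_derive_Cmod g t l :
  path_derive g t l -> g t <> 0%C ->
  is_derive (fun s => Cmod (g s)) t
    ((Re (g t) * Re l + Im (g t) * Im l) / Cmod (g t)).
Proof.
  intros [H1 H2] H0. apply Cmod_gt_0 in H0.
  pose proof (Cmod_sqr (g t)) as Hq.
  eapply is_derive_ext with (f := fun s => sqrt (Re (g s) * Re (g s) + Im (g s) * Im (g s))).
  { intros s. rewrite <- Cmod_sqr. apply sqrt_square, Cmod_ge_0. }
  evar_last.
  - apply is_derive_sqrt.
    + apply @is_derive_plus; apply is_derive_Rmult; eassumption.
    + rewrite <- Hq. nra.
  - cbv beta. rewrite <- Hq, sqrt_square by apply Cmod_ge_0. unfold plus; cbn -[Cmod Re Im]. field. lra.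
Qed.

Lemma path_derive_Clog g t l :
  path_derive g t l -> cut_plane (g t) ->
  path_derive (fun s => Clog (g s)) t (l / g t)%C.
Proof.
  intros Hg Hc. pose proof (cut_plane_neq_0 _ Hc) as H0.
  pose proof (path_derive_Cmod _ _ _ Hg H0) as Hm.
  destruct Hg as [H1 H2].
  pose proof (Cmod_sqr (g t)) as Hq.
  assert (Hr : 0 < Cmod (g t)) by (apply Cmod_gt_0, H0).
  assert (Hp := @is_derive_plus _ _ _ _ _ _ _ Hm H1).
  assert (E : Re (g t) * Re (g t) + Im (g t) * Im (g t) <> 0) by nra.
  assert (E' : Re (g t) ^ 2 + Im (g t) ^ 2 <> 0) by (simpl; nra).
  split.
  - evar_last.
    + unfold Clog; simpl. apply (is_derive_comp ln (fun s => Cmod (g s))).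
      * apply is_derive_ln, Hr.
      * exact Hm.
    + transitivity ((Re (g t) * Re l + Im (g t) * Im l) / (Cmod (g t) * Cmod (g t))).
      { unfold scal; simpl; unfold mult; simpl. field. lra. }
      rewrite Hq. unfold Cdiv, Cinv, Cmult, Re, Im in *; simpl. field; auto.
  (* The half-angle formula is valid on a whole neighbourhood of [t], its denominator being
     continuous and positive there. *)
  - apply is_derive_ext_loc with
      (f := fun s => 2 * atan (Im (g s) / (Cmod (g s) + Re (g s)))).
    { assert (Hl : locally t (fun s => 0 < Cmod (g s) + Re (g s))).
      { assert (Hcont : continuous (fun s => plus (Cmod (g s)) (Re (g s))) t).
        { apply (ex_derive_continuous (V := R_NormedModule)). eexists; exact Hp. }
        apply Hcont. apply open_gt. exact Hc. }
      revert Hl; apply filter_imp. intros s Hs. symmetry. apply Carg_half_angle, Hs. }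
    unfold cut_plane in Hc.
    evar_last.
    + apply is_derive_scal. apply (is_derive_comp atan).
      * apply is_derive_atan.
      * apply is_derive_div; [exact H2 | exact Hp | apply Rgt_not_eq, Hc].
    + replace (Im (l / g t)%C) with ((Im l * Re (g t) - Re l * Im (g t)) / (Cmod (g t) * Cmod (g t))).
      2:{ rewrite Hq. unfold Cdiv, Cinv, Cmult, Re, Im in *; simpl. field; auto. }
      unfold plus, scal; cbn -[Im Re Cmod]; unfold mult; cbn -[Im Re Cmod]; unfold Rsqr.
      set (r := Cmod (g t)) in *. set (u := Re (g t)) in *. set (v := Im (g t)) in *.
      (* Eliminating v^2 collapses the denominator in the derivative of [atan]: (r + u)^2 + v^2 =
         2r(r + u). *)
      assert (Hv : v * v = r * r - u * u) by lra.
      assert (H5 : (r + u) * (r + u) + v * v = 2 * r * (r + u)) by (rewrite Hv; ring).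
      replace (1 + v / (r + u) * (v / (r + u))) with (2 * r / (r + u)).
      2:{ transitivity (((r + u) * (r + u) + v * v) / ((r + u) * (r + u))); [rewrite H5|]; field; lra. }
      transitivity ((Im l * (r + u) * r - v * (u * Re l + r * Re l) - v * v * Im l) / (r * r * (r + u))).
      { field. lra. }
      rewrite Hv. field. lra.
Qed.

(** * Taylor remainders and the binomial series *)

Definition Csum (f : nat -> C) (n : nat) : C := @sum_n C_AbelianMonoid f n.

Lemma Csum_S (f : nat -> C) n : Csum f (S n) = (Csum f n + f (S n))%C.
Proof. exact (sum_Sn (G := C_AbelianMonoid) f n). Qed.

Lemma Csum_0 (f : nat -> C) : Csum f 0 = f 0%nat.
Proof. exact (sum_O (G := C_AbelianMonoid) f). Qed.

Lemma Csum_ext (f g : nat -> C) n :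
  (forall k, (k <= n)%nat -> f k = g k) -> Csum f n = Csum g n.
Proof. exact (sum_n_ext_loc (G := C_AbelianMonoid) f g n). Qed.

Lemma Csum_plus (f g : nat -> C) n :
  Csum (fun k => f k + g k)%C n = (Csum f n + Csum g n)%C.
Proof. induction n; rewrite ?Csum_0, ?Csum_S, ?IHn; ring. Qed.

Lemma Csum_scal (c : C) (f : nat -> C) n :
  Csum (fun k => c * f k)%C n = (c * Csum f n)%C.
Proof. induction n; rewrite ?Csum_0, ?Csum_S, ?IHn; ring. Qed.

Lemma Csum_zero (f : nat -> C) n : (forall k, (k <= n)%nat -> f k = 0%C) -> Csum f n = 0%C.
Proof.
  induction n; intros H; rewrite ?Csum_0, ?Csum_S, ?H; auto.
  rewrite IHn; [ring|]. intros; apply H; lia.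
Qed.

Lemma is_pseries_C (u : nat -> C) (x l : C) :
  @is_pseries C_AbsRing C_NormedModule u x l <->
  forall eps, 0 < eps -> exists N, forall n, (N <= n)%nat ->
    Cmod (Csum (fun k => x ^ k * u k)%C n - l) < eps.
Proof.
  unfold is_pseries, is_series. rewrite (filterlim_locally_ball_norm (U := C_NormedModule)).
  assert (E : forall n, @sum_n C_NormedModule (fun k => scal (pow_n (x : C_AbsRing) k) (u k)) n
    = Csum (fun k => x ^ k * u k)%C n).
  { intros n. apply Csum_ext. intros k _. reflexivity. }
  split; intros H.
  - intros eps He. destruct (H (mkposreal eps He)) as [N HN]. exists N. intros n Hn.
    specialize (HN n Hn). unfold ball_norm in HN. simpl in HN. rewrite E in HN. exact HN.
  - intros eps. destruct (H eps (cond_pos eps)) as [N HN]. exists N. intros n Hn.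
    specialize (HN n Hn). unfold ball_norm. simpl. rewrite E. exact HN.
Qed.

Lemma is_pseries_C_unique (u : nat -> C) (x l l' : C) :
  @is_pseries C_AbsRing C_NormedModule u x l ->
  @is_pseries C_AbsRing C_NormedModule u x l' -> l = l'.
Proof. intros H H'. exact (filterlim_locally_unique (V := C_NormedModule) _ _ _ H H'). Qed.

Lemma is_pseries_C_ext (u v : nat -> C) (x l : C) :
  (forall n, u n = v n) ->
  @is_pseries C_AbsRing C_NormedModule u x l -> @is_pseries C_AbsRing C_NormedModule v x l.
Proof. intros H. apply is_pseries_ext, H. Qed.

Lemma Cmod_le_Re_Im (w : C) : Cmod w <= Rabs (Re w) + Rabs (Im w).
Proof.
  pose proof (Cmod_sqr w). pose proof (Cmod_ge_0 w).
  pose proof (Rabs_pos (Re w)). pose proof (Rabs_pos (Im w)).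
  assert (Re w * Re w = Rabs (Re w) * Rabs (Re w)) by (rewrite <- Rabs_mult, Rabs_right; nra).
  assert (Im w * Im w = Rabs (Im w) * Rabs (Im w)) by (rewrite <- Rabs_mult, Rabs_right; nra).
  nra.
Qed.

Lemma mean_value_bound (f df : R -> R) (B : R) :
  (forall t, 0 <= t <= 1 -> is_derive f t (df t)) ->
  (forall t, 0 <= t <= 1 -> Rabs (df t) <= B) -> Rabs (f 1 - f 0) <= B.
Proof.
  intros Hd HB. destruct (MVT_gen f 0 1 df) as [c [Hc E]];
    rewrite ?Rmin_left, ?Rmax_right in * by lra.
  - intros t Ht; apply Hd; lra.
  - intros t Ht. apply continuity_pt_filterlim.
    apply (ex_derive_continuous (V := R_NormedModule)). eexists; apply Hd; lra.
  - rewrite E, Rminus_0_r, Rmult_1_r. apply HB, Hc.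
Qed.

(** The mean value theorem fails for complex values; applying it to each coordinate costs the factor
    2. *)
Lemma path_mean_value_bound (f df : R -> C) (B : R) :
  (forall t, 0 <= t <= 1 -> path_derive f t (df t)) ->
  (forall t, 0 <= t <= 1 -> Cmod (df t) <= B) -> Cmod (f 1 - f 0) <= 2 * B.
Proof.
  intros Hd HB. eapply Rle_trans; [apply Cmod_le_Re_Im|].
  assert (Rabs (Re (f 1 - f 0)%C) <= B).
  { apply (mean_value_bound (fun t => Re (f t)) (fun t => Re (df t))).
    - intros t Ht; apply Hd, Ht.
    - intros t Ht. eapply Rle_trans; [apply re_le_Cmod | apply HB, Ht]. }
  assert (Rabs (Im (f 1 - f 0)%C) <= B).
  { apply (mean_value_bound (fun t => Im (f t)) (fun t => Im (df t))).
    - intros t Ht; apply Hd, Ht.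
    - intros t Ht. eapply Rle_trans; [|apply HB, Ht].
      pose proof (Cmod_sqr (df t)). pose proof (Cmod_ge_0 (df t)).
      apply Rabs_le. split; nra. }
  lra.
Qed.

Lemma INR_fact_C_neq_0 n : RtoC (INR (fact n)) <> 0%C.
Proof. intros E. apply RtoC_inj in E. exact (INR_fact_neq_0 n E). Qed.

Lemma is_derive_one_minus_pow n t :
  is_derive (fun s => (1 - s) ^ S n) t (- INR (S n) * (1 - t) ^ n).
Proof.
  evar_last.
  - apply (is_derive_comp (fun x => x ^ S n) (fun s => 1 - s)); [apply is_derive_Reals, derivable_pt_lim_pow|].
    auto_derive; auto.
  - unfold scal; simpl; unfold mult; simpl. ring.
Qed.

Lemma RtoC_neq_0 (x : R) : x <> 0 -> RtoC x <> 0%C.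
Proof. intros H E; apply H, RtoC_inj, E. Qed.

(* The partial sums of the Taylor series of [g 0] expanded at [t] and evaluated
   at [1]: all but one term of their derivative in [t] cancel. *)
Lemma path_derive_taylor (g : nat -> R -> C) (N : nat) (t : R) :
  (forall n, path_derive (g n) t (g (S n) t)) ->
  path_derive (fun s => Csum (fun n => RtoC ((1 - s) ^ n / INR (fact n)) * g n s)%C N) t
    (RtoC ((1 - t) ^ N / INR (fact N)) * g (S N) t)%C.
Proof.
  intros Hg. induction N as [|N IH].
  - apply path_derive_ext with (f := g 0%nat).
    + intros s. rewrite Csum_0. simpl. replace (1 / 1) with 1 by field. ring.
    + eapply path_derive_eq; [apply Hg|]. simpl. replace (1 / 1) with 1 by field. ring.
  - apply path_derive_ext with (f := fun s =>
      (Csum (fun n => RtoC ((1 - s) ^ n / INR (fact n)) * g n s) N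
       + RtoC ((1 - s) ^ S N / INR (fact (S N))) * g (S N) s)%C).
    { intros s. rewrite Csum_S. reflexivity. }
    eapply path_derive_eq.
    + apply path_derive_plus; [exact IH|].
      apply path_derive_mult; [|apply Hg].
      apply (path_derive_real (fun s => (1 - s) ^ S N / INR (fact (S N)))).
      apply is_derive_ext with (f := fun s => / INR (fact (S N)) * (1 - s) ^ S N).
      { intros s; unfold Rdiv; apply Rmult_comm. }
      apply is_derive_scal, is_derive_one_minus_pow.
    + replace (/ INR (fact (S N)) * (- INR (S N) * (1 - t) ^ N))
        with (- ((1 - t) ^ N / INR (fact N))).
      * rewrite RtoC_opp. ring.
      * rewrite fact_simpl, mult_INR. field. split; [apply INR_fact_neq_0 | apply not_0_INR; lia].
Qed.

(** The expansion point moves along the segment: the sum in [path_derive_taylor] is the Taylor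
    polynomial at s = 0 and the value [g 0%nat 1] at s = 1, so a bound on its derivative bounds the
    error. *)
Lemma taylor_remainder_bound (g : nat -> R -> C) (N : nat) (B : R) :
  (forall n t, 0 <= t <= 1 -> path_derive (g n) t (g (S n) t)) ->
  (forall t, 0 <= t <= 1 -> (1 - t) ^ N / INR (fact N) * Cmod (g (S N) t) <= B) ->
  Cmod (Csum (fun n => g n 0 / INR (fact n))%C N - g 0%nat 1) <= 2 * B.
Proof.
  intros Hd HB.
  pose (phi := fun s : R => Csum (fun n => RtoC ((1 - s) ^ n / INR (fact n)) * g n s)%C N).
  assert (E0 : phi 0 = Csum (fun n => g n 0 / INR (fact n))%C N).
  { apply Csum_ext. intros n _. rewrite Rminus_0_r, pow1, RtoC_div by apply INR_fact_neq_0.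
    field. apply INR_fact_C_neq_0. }
  assert (E1 : phi 1 = g 0%nat 1).
  { unfold phi. clear. induction N as [|N IH].
    - rewrite Csum_0. simpl. replace (1 / 1) with 1 by field. ring.
    - rewrite Csum_S, IH. rewrite Rminus_diag, pow_i by lia. unfold Rdiv. rewrite Rmult_0_l. ring. }
  rewrite <- E0, <- E1, <- Cmod_opp.
  replace (- (phi 0 - phi 1))%C with (phi 1 - phi 0)%C by ring.
  apply (path_mean_value_bound phi (fun t => RtoC ((1 - t) ^ N / INR (fact N)) * g (S N) t)%C).
  - intros t Ht. apply path_derive_taylor. intros n. apply Hd, Ht.
  - intros t Ht. rewrite Cmod_mult, Cmod_R, Rabs_right; [apply HB, Ht|].
    apply Rle_ge, Rmult_le_pos; [apply pow_le; lra | left; apply Rinv_0_lt_compat, INR_fact_lt_0].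
Qed.

(** Real majorant, both of |<p>_n| and of the factors produced by repeated differentiation. *)
Fixpoint Rrising (K : R) (n : nat) : R :=
  match n with O => 1 | S j => Rrising K j * (K + INR j) end.

Lemma Rrising_pos K n : 0 < K -> 0 < Rrising K n.
Proof.
  intros H. induction n; simpl; [lra|]. pose proof (pos_INR n). apply Rmult_lt_0_compat; lra.
Qed.

(** Ratio test: consecutive terms have ratio y (1 + K / (n + 1)), which tends to y < 1. The index
    [S n] over n! is that of a Taylor remainder, a derivative of order n + 1 divided by n!. *)
Lemma Rrising_geometric_lim (K y : R) :
  0 < K -> 0 < y < 1 -> is_lim_seq (fun n => Rrising K (S n) * y ^ S n / INR (fact n)) 0.
Proof.
  intros HK Hy. set (u := fun n => _).
  assert (Hu : forall n, 0 < u n).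
  { intros n. unfold u. apply Rdiv_lt_0_compat; [|apply INR_fact_lt_0].
    apply Rmult_lt_0_compat; [apply Rrising_pos, HK | apply pow_lt; lra]. }
  assert (H : ex_series (fun n => Rabs (u n))).
  { apply ex_series_DAlembert with y; [lra| |].
    - intros n. apply Rgt_not_eq, Hu.
    - apply is_lim_seq_ext with (fun n => y * (1 + K * / INR (S n))).
      + intros n. rewrite Rabs_right.
        * unfold u. rewrite fact_simpl, mult_INR. cbn [Rrising pow].
          pose proof (pos_INR n). pose proof (Rrising_pos K n HK).
          rewrite S_INR. field. repeat split; try apply INR_fact_neq_0; try lra.
          apply pow_nonzero; lra.
        * apply Rle_ge. left. apply Rdiv_lt_0_compat; apply Hu.
      + replace (Finite y) with (Rbar_mult y (1 + 0)) by (simpl; f_equal; ring).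
        apply is_lim_seq_scal_l, is_lim_seq_plus'; [apply is_lim_seq_const|].
        replace (Finite 0) with (Rbar_mult K 0) by (simpl; f_equal; ring).
        apply is_lim_seq_scal_l.
        apply (is_lim_seq_inv _ p_infty); [|discriminate].
        apply -> is_lim_seq_incr_1. apply is_lim_seq_INR. }
  apply ex_series_lim_0 in H. apply is_lim_seq_ext with (2 := H).
  intros n. apply Rabs_right. left. apply Hu.
Qed.

(** * Principal powers and falling factorials *)

Lemma Clog_1 : Clog 1 = 0%C.
Proof.
  unfold Clog, Carg. rewrite Cmod_1, ln_1. simpl.
  destruct (Rlt_dec 0 0); [lra|]. rewrite Rdiv_1_r, acos_1. reflexivity.
Qed.

Lemma Ccpow_neq_0 (z s : C) : z <> 0%C -> Ccpow z s = Cexp (s * Clog z).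
Proof. intros H. unfold Ccpow. destruct (Ceq_dec z 0); [contradiction | reflexivity]. Qed.

Lemma Ccpow_minus_1 (z s : C) : z <> 0%C -> (z * Ccpow z (s - 1) = Ccpow z s)%C.
Proof.
  intros H. rewrite !Ccpow_neq_0 by exact H.
  rewrite <- (Cexp_Clog z H) at 1. rewrite <- Cexp_plus. f_equal. ring.
Qed.

Lemma Ccpow_0_r (z : C) : Ccpow z 0 = 1%C.
Proof.
  unfold Ccpow. destruct (Ceq_dec z 0).
  - destruct (Ceq_dec 0 0); congruence.
  - rewrite Cmult_0_l. apply Cexp_0.
Qed.

Lemma Ccpow_INR (z : C) (n : nat) : Ccpow z (INR n) = (z ^ n)%C.
Proof.
  induction n as [|n IH]; [apply Ccpow_0_r|].
  destruct (Ceq_dec z 0) as [->|H].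
  - unfold Ccpow. destruct (Ceq_dec 0 0) as [_|]; [|congruence].
    destruct (Ceq_dec (INR (S n)) 0) as [E|_]; [|simpl; ring].
    apply RtoC_inj in E. exfalso. revert E. apply not_0_INR. lia.
  - rewrite <- Ccpow_minus_1 by exact H. simpl Cpow. rewrite <- IH. do 2 f_equal.
    rewrite S_INR, RtoC_plus. ring.
Qed.

Lemma path_derive_Ccpow g t l (s : C) :
  path_derive g t l -> cut_plane (g t) ->
  path_derive (fun r => Ccpow (g r) s) t (s * Ccpow (g t) (s - 1) * l)%C.
Proof.
  intros Hg Hc. pose proof (cut_plane_neq_0 _ Hc) as H0.
  apply path_derive_ext_loc with (f := fun r => Cexp (s * Clog (g r))).
  - assert (Hl : locally t (fun r => 0 < Cmod (g r))).
    { assert (Hcont : continuous (fun r => Cmod (g r)) t).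
      { apply (ex_derive_continuous (V := R_NormedModule)). eexists.
        apply (path_derive_Cmod _ _ _ Hg H0). }
      apply Hcont. apply open_gt. apply Cmod_gt_0, H0. }
    revert Hl; apply filter_imp. intros r Hr. symmetry. apply Ccpow_neq_0, Cmod_gt_0, Hr.
  - eapply path_derive_eq.
    + apply path_derive_Cexp, path_derive_scal, path_derive_Clog; [exact Hg | exact Hc].
    + cbv beta. rewrite <- (Ccpow_neq_0 _ s H0), <- (Ccpow_minus_1 _ s H0). field. exact H0.
Qed.

Lemma falling_S_l (p : C) n : (falling p (S n) = p * falling (p - 1) n)%C.
Proof.
  induction n as [|n IH]; [simpl; ring|].
  change (falling p (S (S n))) with (falling p (S n) * (p - INR (S n)))%C.
  rewrite IH. change (falling (p - 1) (S n)) with (falling (p - 1) n * (p - 1 - INR n))%C.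
  rewrite S_INR, RtoC_plus. ring.
Qed.

Lemma falling_plus (p : C) n k :
  (falling p (n + k) = falling p k * falling (p - INR k) n)%C.
Proof.
  induction n as [|n IH]; [simpl; ring|].
  simpl. rewrite IH, plus_INR, RtoC_plus. ring.
Qed.

Lemma Cmod_falling_le (p : C) n : Cmod (falling p n) <= Rrising (Cmod p) n.
Proof.
  induction n as [|n IH]; simpl; [rewrite Cmod_1; lra|].
  rewrite Cmod_mult. apply Rmult_le_compat; auto using Cmod_ge_0.
  eapply Rle_trans; [apply Cmod_triangle|]. rewrite Cmod_opp, Cmod_R, Rabs_right; [lra|].
  apply Rle_ge, pos_INR.
Qed.

Lemma Rrising_le K K' n : 0 <= K <= K' -> 0 <= Rrising K n <= Rrising K' n.
Proof.
  intros H. induction n as [|n IH]; simpl; [lra|]. pose proof (pos_INR n).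
  split; [apply Rmult_le_pos; lra | apply Rmult_le_compat; lra].
Qed.

Lemma Cmod_Clog_le (w : C) : Cmod (Clog w) <= Rabs (ln (Cmod w)) + PI.
Proof.
  eapply Rle_trans; [apply Cmod_le_Re_Im|]. simpl. apply Rplus_le_compat_l.
  unfold Carg. pose proof (acos_bound (Re w / Cmod w)). pose proof PI_RGT_0.
  destruct (Rlt_dec (Im w) 0); apply Rabs_le; lra.
Qed.

Lemma Rabs_ln_le (x lo hi : R) : 0 < lo -> lo <= x <= hi -> Rabs (ln x) <= Rabs (ln lo) + Rabs (ln hi).
Proof.
  intros Hlo Hx. assert (ln lo <= ln x) by (apply ln_le; lra).
  assert (ln x <= ln hi) by (apply ln_le; lra).
  pose proof (Rle_abs (ln hi)). pose proof (Rle_abs (- ln lo)). rewrite Rabs_Ropp in *.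
  pose proof (Rabs_pos (ln hi)). pose proof (Rabs_pos (ln lo)).
  apply Rabs_le. lra.
Qed.

Lemma Re_le_Cmod (w : C) : Re w <= Cmod w.
Proof. eapply Rle_trans; [apply Rle_abs | apply re_le_Cmod]. Qed.

(** The argument is bounded by PI, so a complex power is bounded uniformly once |w| stays away from
    0 and infinity. *)
Lemma Cmod_Cexp_mult_Clog_le (s w : C) (lo hi : R) :
  0 < lo -> lo <= Cmod w <= hi ->
  Cmod (Cexp (s * Clog w)) <= exp (Cmod s * (Rabs (ln lo) + Rabs (ln hi) + PI)).
Proof.
  intros Hlo Hw. rewrite Cmod_Cexp.
  assert (Re (s * Clog w) <= Cmod s * (Rabs (ln lo) + Rabs (ln hi) + PI)).
  { eapply Rle_trans; [apply Re_le_Cmod|]. rewrite Cmod_mult.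
    apply Rmult_le_compat_l; [apply Cmod_ge_0|].
    eapply Rle_trans; [apply Cmod_Clog_le|]. pose proof (Rabs_ln_le _ _ _ Hlo Hw). lra. }
  destruct H as [H|H]; [left; apply exp_increasing, H | rewrite H; lra].
Qed.

(** * Binomial series, in the disc and for natural exponents *)

Lemma Cmod_one_plus_ge (z : C) (t : R) : 0 <= t <= 1 -> 1 - t * Cmod z <= Cmod (1 + t * z).
Proof.
  intros Ht. pose proof (Cmod_triangle (1 + t * z) (- (t * z))) as H.
  replace (1 + t * z + - (t * z))%C with (RtoC 1) in H by ring.
  rewrite Cmod_1, Cmod_opp, Cmod_mult, Cmod_R, (Rabs_right t) in H by lra. lra.
Qed.

Lemma cut_plane_one_plus (z : C) : Cmod z < 1 -> cut_plane (1 + z).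
Proof.
  intros H. apply cut_plane_intro. right. pose proof (re_le_Cmod z).
  pose proof (Rabs_def2 (Re z) 1). simpl. unfold Re in *. lra.
Qed.

(** Taylor's formula for (1 + t z)^p on [0, 1]. The power (1 + t z)^(p - N - 1) may be large, but 1
    - t <= |1 + t z|, so the factor (1 - t)^N of the remainder absorbs N of the negative powers.
    This is what reaches the whole unit disc. *)
Lemma binomial_series_disc (p z : C) :
  Cmod z < 1 ->
  @is_pseries C_AbsRing C_NormedModule
    (fun n => falling p n / INR (fact n))%C z (Ccpow (1 + z) p).
Proof.
  intros Hz. pose proof (Cmod_ge_0 z) as Hz0.
  set (g := fun n (t : R) => (falling p n * z ^ n * Ccpow (1 + t * z) (p - INR n))%C).
  assert (Hcut : forall t, 0 <= t <= 1 -> cut_plane (1 + t * z)).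
  { intros t Ht. apply cut_plane_one_plus. rewrite Cmod_mult, Cmod_R, Rabs_right by lra. nra. }
  assert (Hd : forall n t, 0 <= t <= 1 -> path_derive (g n) t (g (S n) t)).
  { intros n t Ht. eapply path_derive_eq.
    - apply path_derive_scal. apply path_derive_Ccpow.
      + apply (path_derive_line 1 z).
      + apply Hcut, Ht.
    - unfold g. cbn [falling Cpow]. rewrite S_INR, RtoC_plus.
      replace (p - (INR n + 1))%C with (p - INR n - 1)%C by ring. ring. }
  set (M := exp (Cmod (p - 1) * (Rabs (ln (1 - Cmod z)) + Rabs (ln 2) + PI))).
  assert (HM : forall t, 0 <= t <= 1 -> Cmod (Ccpow (1 + t * z) (p - 1)) <= M).
  { intros t Ht. rewrite Ccpow_neq_0 by apply cut_plane_neq_0, Hcut, Ht.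
    apply Cmod_Cexp_mult_Clog_le; [lra|]. split.
    - pose proof (Cmod_one_plus_ge z t Ht). nra.
    - eapply Rle_trans; [apply Cmod_triangle|].
      rewrite Cmod_1, Cmod_mult, Cmod_R, Rabs_right by lra. nra. }
  assert (HM0 : 0 < M) by apply exp_pos.
  (* [y] is strictly between |z| and 1 and [K] exceeds |p|; both stay positive when z = 0 or p = 0,
     as [Rrising_geometric_lim] requires. *)
  set (y := (1 + Cmod z) / 2). set (K := Cmod p + 1).
  assert (HB : forall N t, 0 <= t <= 1 -> (1 - t) ^ N / INR (fact N) * Cmod (g (S N) t) <=
     M * (Rrising K (S N) * y ^ S N / INR (fact N))).
  { intros N t Ht.
    assert (Hc : Cmod (1 + t * z)%C <> 0) by (apply Rgt_not_eq, Cmod_gt_0, cut_plane_neq_0, Hcut, Ht).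
    assert (E : Cmod (1 + t * z)%C ^ N * Cmod (Ccpow (1 + t * z) (p - INR (S N)))
                = Cmod (Ccpow (1 + t * z) (p - 1))).
    { rewrite <- Cmod_pow, <- Cmod_mult. f_equal.
      clear -Hc. induction N as [|N IH].
      - simpl. rewrite Cmult_1_l. reflexivity.
      - rewrite <- IH. rewrite S_INR, RtoC_plus. simpl Cpow.
        replace (p - (INR (S N) + 1))%C with (p - INR (S N) - 1)%C by ring.
        rewrite <- (Ccpow_minus_1 _ (p - INR (S N))%C); [ring|].
        intros E0; rewrite E0, Cmod_0 in Hc; lra. }
    unfold g. rewrite !Cmod_mult, Cmod_pow.
    pose proof (HM t Ht) as HMt. rewrite <- E in HMt.
    assert (Hp1 : (1 - t) ^ N <= Cmod (1 + t * z)%C ^ N).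
    { apply pow_incr. pose proof (Cmod_one_plus_ge z t Ht). nra. }
    assert (Hp2 : Cmod (falling p (S N)) <= Rrising K (S N)).
    { eapply Rle_trans; [apply Cmod_falling_le|]. apply Rrising_le.
      unfold K; pose proof (Cmod_ge_0 p); lra. }
    assert (Hp3 : Cmod z ^ S N <= y ^ S N) by (apply pow_incr; unfold y; lra).
    pose proof (INR_fact_lt_0 N) as Hf.
    pose proof (Cmod_ge_0 (Ccpow (1 + t * z) (p - INR (S N)))) as Hq.
    set (q := Cmod (Ccpow (1 + t * z) (p - INR (S N)))) in *.
    assert (Hp4 : (1 - t) ^ N * q <= M).
    { eapply Rle_trans; [|exact HMt]. apply Rmult_le_compat_r; auto. }
    replace ((1 - t) ^ N / INR (fact N) * (Cmod (falling p (S N)) * Cmod z ^ S N * q))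
      with (((1 - t) ^ N * q) * (Cmod (falling p (S N)) * Cmod z ^ S N / INR (fact N)))
      by (field; lra).
    assert (0 <= (1 - t) ^ N * q) by (apply Rmult_le_pos; auto; apply pow_le; lra).
    assert (0 < / INR (fact N)) by apply Rinv_0_lt_compat, Hf.
    assert (0 <= Cmod z ^ S N) by (apply pow_le; lra).
    pose proof (Cmod_ge_0 (falling p (S N))).
    apply Rmult_le_compat; auto.
    - apply Rmult_le_pos; [|lra]. apply Rmult_le_pos; auto.
    - apply Rmult_le_compat_r; [lra|]. apply Rmult_le_compat; auto. }
  apply is_pseries_C. intros eps He.
  assert (Hlim : is_lim_seq (fun n => Rrising K (S n) * y ^ S n / INR (fact n)) 0).
  { apply Rrising_geometric_lim; unfold K, y; [pose proof (Cmod_ge_0 p); lra | lra]. }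
  apply is_lim_seq_spec in Hlim.
  (* The remainder is at most 2 M times the null sequence; 3 in place of 2 leaves room for a strict
     inequality. *)
  assert (He' : 0 < eps / (3 * M)) by (apply Rdiv_lt_0_compat; lra).
  destruct (Hlim (mkposreal _ He')) as [N HN]. exists N. intros n Hn.
  specialize (HN n Hn). simpl pos in HN. rewrite Rminus_0_r in HN. apply Rabs_def2 in HN.
  destruct HN as [HN _].
  pose proof (taylor_remainder_bound g n _ Hd (HB n)) as HT.
  apply Rle_lt_trans with (2 * (M * (eps / (3 * M)))).
  - eapply Rle_trans; [|apply Rle_trans with (1 := HT); apply Rmult_le_compat_l; [lra|];
      apply Rmult_le_compat_l; lra].
    right. f_equal. f_equal.
    + apply Csum_ext. intros k _. unfold g. rewrite Cmult_0_l, Cplus_0_r.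
      rewrite (Ccpow_neq_0 1), Clog_1 by exact C1_nz.
      rewrite Cmult_0_r, Cexp_0. field. apply INR_fact_C_neq_0.
    + unfold g. simpl falling. simpl Cpow. simpl INR. rewrite !Cmult_1_l.
      f_equal. f_equal; ring.
  - replace (2 * (M * (eps / (3 * M)))) with (2 / 3 * eps) by (field; lra). lra.
Qed.

Lemma falling_pascal (p : C) n :
  (falling (p + 1) (S n) = falling p (S n) + INR (S n) * falling p n)%C.
Proof.
  rewrite falling_S_l. replace (p + 1 - 1)%C with p by ring.
  cbn [falling]. rewrite S_INR, RtoC_plus. ring.
Qed.

(** Pascal's rule as multiplication by 1 + z. The second sum is one term shorter, which is harmless
    for a natural exponent once both sums have passed the degree. *)
Lemma binomial_partial_sum_succ (p z : C) N :
  Csum (fun n => z ^ n * (falling (p + 1) n / INR (fact n)))%C (S N) =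
  (Csum (fun n => z ^ n * (falling p n / INR (fact n)))%C (S N) +
   z * Csum (fun n => z ^ n * (falling p n / INR (fact n)))%C N)%C.
Proof.
  assert (Hterm : forall n, (z ^ S n * (falling (p + 1) (S n) / INR (fact (S n))) =
    z ^ S n * (falling p (S n) / INR (fact (S n))) + z * (z ^ n * (falling p n / INR (fact n))))%C).
  { intros n. rewrite falling_pascal, fact_simpl, mult_INR, RtoC_mult. cbn [Cpow]. field.
    split; [apply INR_fact_C_neq_0 | apply RtoC_neq_0, not_0_INR; lia]. }
  induction N as [|N IH].
  - rewrite !Csum_S, !Csum_0, Hterm. simpl. field.
  - rewrite Csum_S, IH, (Csum_S _ (S N)), (Csum_S _ N), Hterm. ring.
Qed.

Lemma falling_INR_0 q n : (q < n)%nat -> falling (INR q) n = 0%C.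
Proof.
  induction n as [|n IH]; intros H; [lia|]. simpl.
  destruct (Nat.eq_dec q n) as [->|Hne]; [ring|]. rewrite IH by lia. ring.
Qed.

Lemma binomial_theorem_falling q (z : C) N : (q <= N)%nat ->
  Csum (fun n => z ^ n * (falling (INR q) n / INR (fact n)))%C N = ((1 + z) ^ q)%C.
Proof.
  revert N. induction q as [|q IH]; intros N HN.
  - induction N as [|N IHN]; [rewrite Csum_0; simpl; field|].
    rewrite Csum_S, IHN, falling_INR_0 by lia. simpl Cpow. unfold Cdiv. ring.
  - destruct N as [|N]; [lia|]. rewrite S_INR, RtoC_plus, binomial_partial_sum_succ, !IH by lia.
    simpl. ring.
Qed.

Lemma binomial_series_nat q (z : C) :
  @is_pseries C_AbsRing C_NormedModule
    (fun n => falling (INR q) n / INR (fact n))%C z ((1 + z) ^ q)%C.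
Proof.
  apply is_pseries_C. intros eps He. exists q. intros n Hn.
  rewrite binomial_theorem_falling by exact Hn.
  replace (_ - _)%C with (RtoC 0) by ring. rewrite Cmod_0. exact He.
Qed.

Lemma is_pseries_C_scal (c : C) (u : nat -> C) (z l : C) :
  @is_pseries C_AbsRing C_NormedModule u z l ->
  @is_pseries C_AbsRing C_NormedModule (fun n => c * u n)%C z (c * l)%C.
Proof.
  intros H. apply (is_pseries_scal (V := C_NormedModule) c u z l); [apply Cmult_comm | exact H].
Qed.

Lemma is_pseries_C_plus (u v : nat -> C) (z l l' : C) :
  @is_pseries C_AbsRing C_NormedModule u z l -> @is_pseries C_AbsRing C_NormedModule v z l' ->
  @is_pseries C_AbsRing C_NormedModule (fun n => u n + v n)%C z (l + l')%C.
Proof. apply (is_pseries_plus (V := C_NormedModule)). Qed.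

(** For p = q natural and k > q the exponent p - k is negative, but <q>_k = 0 annihilates both
    sides, whatever [Ccpow] gives, even at 1 + z = 0. *)
Lemma binomial_series_shifted (p z : C) k :
  Cmod z < 1 \/ (exists q : nat, p = INR q) ->
  @is_pseries C_AbsRing C_NormedModule
    (fun n => falling p (n + k) / INR (fact n))%C z
    (falling p k * Ccpow (1 + z) (p - INR k))%C.
Proof.
  intros H.
  apply is_pseries_C_ext with (u := fun n => (falling p k * (falling (p - INR k) n / INR (fact n)))%C).
  { intros n. rewrite falling_plus. unfold Cdiv. ring. }
  destruct H as [H|[q ->]].
  - apply is_pseries_C_scal, binomial_series_disc, H.
  - destruct (le_lt_dec k q) as [Hk|Hk].
    + rewrite <- RtoC_minus, <- minus_INR by exact Hk. rewrite Ccpow_INR.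
      apply is_pseries_C_scal, binomial_series_nat.
    + rewrite falling_INR_0 by exact Hk.
      rewrite Cmult_0_l. pose proof (is_pseries_C_scal 0 _ z _ (binomial_series_nat 0 z)) as E.
      rewrite Cmult_0_l in E. apply is_pseries_C_ext with (2 := E). intros n; ring.
Qed.

(** * Analyticity off the origin *)

(** This is (1 + e s)^p s^q with s = [Cexp (L x)]. Carrying a logarithm [L] of s, rather than s
    itself, fixes the branch of s^q. *)
Definition branch_fun (e : C) (L : C -> C) (p q x : C) : C :=
  Cexp (p * Clog (1 + e * Cexp (L x)) + q * L x).

(* The n-th derivative in [x] of [branch_fun e L p q], provided [Cexp (L x) ^ 2 = x]. *)
Fixpoint branch_deriv (e : C) (L : C -> C) (n : nat) (p q x : C) : C :=
  match n with
  | O => branch_fun e L p q x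
  | S j => / 2 * (p * e * branch_deriv e L j (p - 1) (q - 1) x
                  + q * branch_deriv e L j p (q - 2) x)
  end%C.

(** Lowering exponents is division by a fixed quantity. This reduces the derivative formula to a
    field identity and the growth estimate to bounds on that quantity. *)
Lemma branch_fun_shift (e : C) (L : C -> C) (p q x : C) :
  (1 + e * Cexp (L x) <> 0)%C ->
  branch_fun e L (p - 1) (q - 1) x =
    (branch_fun e L p q x / ((1 + e * Cexp (L x)) * Cexp (L x)))%C.
Proof.
  intros H. unfold branch_fun.
  replace ((p - 1) * Clog (1 + e * Cexp (L x)) + (q - 1) * L x)%C with
    ((p * Clog (1 + e * Cexp (L x)) + q * L x) + (- Clog (1 + e * Cexp (L x)) + - L x))%C by ring.
  rewrite (Cexp_plus (_ + _)), (Cexp_plus (- _)), !Cexp_opp, Cexp_Clog by exact H.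
  field. split; [apply Cexp_neq_0 | exact H].
Qed.

Lemma branch_fun_shift2 (e : C) (L : C -> C) (p q x : C) :
  branch_fun e L p (q - 2) x = (branch_fun e L p q x / Cexp (L x) ^ 2)%C.
Proof.
  unfold branch_fun.
  replace (p * Clog (1 + e * Cexp (L x)) + (q - 2) * L x)%C with
    ((p * Clog (1 + e * Cexp (L x)) + q * L x) + (- L x + - L x))%C by ring.
  rewrite (Cexp_plus (_ + _)), (Cexp_plus (- _)), !Cexp_opp.
  field. apply Cexp_neq_0.
Qed.

(** From s^2 = x one has ds/dx = 1/(2s), so differentiating (1 + e s)^p s^q yields the pairs (p - 1,
    q - 1) and (p, q - 2) with weights p e / 2 and q / 2. Calculus enters only at order 0; the
    recursion is linear, so the higher orders follow. *)
Lemma path_derive_branch_deriv (e : C) (L : C -> C) (g : R -> C) (t : R) (h : C) n p q :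
  path_derive (fun s => L (g s)) t (h / (2 * g t))%C ->
  (Cexp (L (g t)) ^ 2)%C = g t ->
  cut_plane (1 + e * Cexp (L (g t))) ->
  path_derive (fun s => branch_deriv e L n p q (g s)) t
    (h * branch_deriv e L (S n) p q (g t))%C.
Proof.
  intros HL Hsq Hcut. revert p q. induction n as [|n IH]; intros p q.
  - pose proof (cut_plane_neq_0 _ Hcut) as H1. pose proof (Cexp_neq_0 (L (g t))) as H2.
    eapply path_derive_eq.
    + apply path_derive_Cexp, path_derive_plus.
      * apply path_derive_scal, path_derive_Clog; [|exact Hcut].
        apply path_derive_plus; [apply path_derive_const|].
        apply path_derive_scal, path_derive_Cexp, HL.
      * apply path_derive_scal, HL.
    + cbn [branch_deriv]. rewrite branch_fun_shift, branch_fun_shift2 by exact H1.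
      unfold branch_fun.
      remember (Cexp (p * Clog (1 + e * Cexp (L (g t))) + q * L (g t))) as F.
      remember (Cexp (L (g t))) as s. rewrite <- Hsq. field. auto.
  - cbn [branch_deriv]. eapply path_derive_eq.
    + apply path_derive_scal, path_derive_plus; apply path_derive_scal; apply IH.
    + cbn [branch_deriv]. ring.
Qed.

Lemma Rrising_S_l K n : Rrising K (S n) = K * Rrising (K + 1) n.
Proof.
  induction n as [|n IH]; [simpl; ring|].
  change (Rrising K (S (S n))) with (Rrising K (S n) * (K + INR (S n))).
  rewrite IH, S_INR. simpl. ring.
Qed.

(** Each differentiation contributes a factor (|p| + |q|) / 2 <= K and a division costing at most B,
    and it raises |p| + |q| by at most 2, hence K by 1. The product K (K + 1) ... (K + n - 1) is
    [Rrising K n]. *)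
Lemma Cmod_branch_deriv_le (e : C) (L : C -> C) (x : C) (B K : R) n p q :
  Cmod e = 1 -> (1 + e * Cexp (L x) <> 0)%C ->
  / (Cmod (1 + e * Cexp (L x)) * Cmod (Cexp (L x))) <= B ->
  / (Cmod (Cexp (L x)) ^ 2) <= B ->
  Cmod p + Cmod q <= 2 * K ->
  Cmod (branch_deriv e L n p q x) <= Cmod (branch_fun e L p q x) * B ^ n * Rrising K n.
Proof.
  intros He H0 HB1 HB2. revert p q K.
  pose proof (Cexp_neq_0 (L x)) as H2.
  assert (HB : 0 < B).
  { eapply Rlt_le_trans; [|exact HB2]. apply Rinv_0_lt_compat, pow_lt, Cmod_gt_0, H2. }
  induction n as [|n IH]; intros p q K HK.
  - simpl. lra.
  - assert (HK0 : 0 <= K) by (pose proof (Cmod_ge_0 p); pose proof (Cmod_ge_0 q); lra).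
    assert (H11 : Cmod (RtoC 1) = 1) by apply Cmod_1.
    assert (H22 : Cmod (RtoC 2) = 2) by (rewrite Cmod_R, Rabs_right; lra).
    pose proof (Cmod_triangle p (- (1))%C) as Tp. rewrite Cmod_opp, H11 in Tp.
    pose proof (Cmod_triangle q (- (1))%C) as Tq. rewrite Cmod_opp, H11 in Tq.
    pose proof (Cmod_triangle q (- (2))%C) as Tq2. rewrite Cmod_opp, H22 in Tq2.
    assert (I1 := IH (p - 1)%C (q - 1)%C (K + 1) ltac:(unfold Cminus; lra)).
    assert (I2 := IH p (q - 2)%C (K + 1) ltac:(unfold Cminus; lra)).
    rewrite branch_fun_shift in I1 by exact H0. rewrite branch_fun_shift2 in I2.
    rewrite Cmod_div, Cmod_mult in I1 by (apply Cmult_neq_0; assumption).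
    rewrite Cmod_div, Cmod_pow in I2 by (apply Cpow_nz; assumption).
    set (F := Cmod (branch_fun e L p q x)) in *.
    assert (HF : 0 <= F) by apply Cmod_ge_0.
    assert (HR : 0 <= B ^ n * Rrising (K + 1) n).
    { apply Rmult_le_pos; [apply pow_le; lra | left; apply Rrising_pos; lra]. }
    assert (J1 : Cmod (branch_deriv e L n (p - 1) (q - 1) x) <= F * B * (B ^ n * Rrising (K + 1) n)).
    { eapply Rle_trans; [exact I1|]. rewrite Rmult_assoc. apply Rmult_le_compat_r; [exact HR|].
      apply Rmult_le_compat_l; assumption. }
    assert (J2 : Cmod (branch_deriv e L n p (q - 2) x) <= F * B * (B ^ n * Rrising (K + 1) n)).
    { eapply Rle_trans; [exact I2|]. rewrite Rmult_assoc. apply Rmult_le_compat_r; [exact HR|].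
      apply Rmult_le_compat_l; assumption. }
    cbn [branch_deriv]. rewrite Rrising_S_l, Cmod_mult, Cmod_inv, H22 by (apply RtoC_neq_0; lra).
    set (X := F * B * (B ^ n * Rrising (K + 1) n)) in *.
    assert (HX : 0 <= X) by (apply Rmult_le_pos; [apply Rmult_le_pos; lra | exact HR]).
    replace (F * B ^ S n * (K * Rrising (K + 1) n)) with (/ 2 * (2 * K * X))
      by (unfold X; simpl; field).
    apply Rmult_le_compat_l; [lra|].
    eapply Rle_trans; [apply Cmod_triangle|]. rewrite !Cmod_mult, He, Rmult_1_r.
    pose proof (Cmod_ge_0 p). pose proof (Cmod_ge_0 q).
    apply Rle_trans with ((Cmod p + Cmod q) * X); [nra|].
    apply Rmult_le_compat_r; assumption.
Qed.

Lemma slit_plane_open (x : C) : slit_plane x ->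
  exists r, 0 < r /\ forall y, Cmod (y - x) < r -> slit_plane y.
Proof.
  intros Hx. destruct (Req_dec (Im x) 0) as [H0|H0].
  - assert (Hr : Re x < 1) by (apply Rnot_le_lt; intros H; apply Hx; auto).
    exists (1 - Re x). split; [lra|]. intros y Hy [_ H].
    pose proof (Re_le_Cmod (y - x)) as E. unfold Cminus in E at 1. rewrite re_plus, re_opp in E. lra.
  - exists (Rabs (Im x)). split; [apply Rabs_pos_lt, H0|]. intros y Hy [H _].
    pose proof (Cmod_sqr (y - x)) as E.
    assert (E' : Im (y - x) = - Im x) by (unfold Cminus; rewrite im_plus, im_opp, H; ring).
    rewrite E' in E.
    pose proof (Cmod_ge_0 (y - x)).
    assert (Rabs (Im x) * Rabs (Im x) = Im x * Im x) by (rewrite <- Rabs_mult, Rabs_right; nra).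
    pose proof (Rabs_pos (Im x)). nra.
Qed.

(** If 1 + s were real and nonpositive, then s <= -1 and s^2 >= 1. Applied to both square roots, it
    keeps 1 + s and 1 - s off the cut of [Clog]. *)
Lemma cut_plane_one_plus_sqrt (s : C) : slit_plane (s ^ 2) -> cut_plane (1 + s).
Proof.
  intros H. apply cut_plane_intro.
  destruct (Req_dec (Im s) 0) as [H0|H0].
  - right. apply Rnot_le_lt. intros H1. apply H.
    rewrite re_plus in H1. change (Re 1) with 1 in H1.
    replace (s ^ 2)%C with (s * s)%C by (simpl; ring).
    rewrite im_mult, re_mult, H0. split; [ring | nra].
  - left. rewrite im_plus. simpl. unfold Im in *. lra.
Qed.

(** Half a logarithm of x that is smooth near x0: the ratio x / x0 is close to 1, far from the cut,
    even when x0 lies on the negative axis. *)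
Definition local_log_sqrt (x0 x : C) : C := (/ 2 * (Clog x0 + Clog (x / x0)))%C.

Lemma Cexp_local_log_sqrt (x0 x : C) : x0 <> 0%C -> x <> 0%C ->
  (Cexp (local_log_sqrt x0 x) ^ 2)%C = x.
Proof.
  intros H0 H. simpl. rewrite Cmult_1_r, <- Cexp_plus. unfold local_log_sqrt.
  replace (_ + _)%C with (Clog x0 + Clog (x / x0))%C by field.
  rewrite Cexp_plus, !Cexp_Clog; [field; auto | | auto].
  apply Cmult_neq_0; [auto | intros E].
  apply (f_equal (Cmult x0)) in E. rewrite Cinv_r, Cmult_0_r in E by exact H0. exact (C1_nz E).
Qed.

Lemma path_derive_local_log_sqrt (x0 h : C) (t : R) :
  x0 <> 0%C -> cut_plane ((x0 + t * h) / x0) ->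
  path_derive (fun s => local_log_sqrt x0 (x0 + s * h)) t (h / (2 * (x0 + t * h)))%C.
Proof.
  intros H0 Hc. pose proof (cut_plane_neq_0 _ Hc) as Hn.
  assert (Hx : (x0 + t * h <> 0)%C).
  { intros E. apply Hn. rewrite E. unfold Cdiv. ring. }
  eapply path_derive_eq.
  - apply path_derive_scal, path_derive_plus; [apply path_derive_const|].
    apply path_derive_Clog; [|exact Hc].
    apply path_derive_mult; [apply path_derive_line | apply path_derive_const].
  - cbv beta. field. auto.
Qed.

(** On a small disc the n-th derivative is at most A B^n (K)_n. With |h| <= 1/(2B) the remainder of
    order N is then dominated by (K)_(N+1) 2^(-N-1) / N!, which tends to 0. *)
Lemma branch_fun_analytic (e p q x0 : C) :
  (e * e = 1)%C -> x0 <> 0%C -> slit_plane x0 ->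
  analytic_at (branch_fun e (local_log_sqrt x0) p q) x0.
Proof.
  intros He H0 Hs. set (L := local_log_sqrt x0).
  assert (Hm0 : 0 < Cmod x0) by (apply Cmod_gt_0, H0).
  assert (Hm1 : 0 < Cmod (1 - x0)).
  { apply Cmod_gt_0. intros E. apply Hs. replace x0 with (RtoC 1).
    - simpl; lra.
    - replace x0 with (1 - (1 - x0))%C by ring. rewrite E. ring. }
  assert (Hme : Cmod e = 1).
  { pose proof (Cmod_ge_0 e). assert (Cmod e * Cmod e = 1) by (rewrite <- Cmod_mult, He; apply Cmod_1). nra. }
  destruct (slit_plane_open x0 Hs) as [r1 [Hr1 Hslit]].
  (* [S0] bounds |s|, as |s|^2 = |x| <= 3/2 |x0|. From (1 + e s)(1 - e s) = 1 - x comes the lower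
     bound [lo] for |1 + e s|, and |s| >= |x0| / (2 S0). The first summand of [B] is the inverse of
     the product of these two lower bounds; the second bounds 1/|s|^2. *)
  set (S0 := 1 + 2 * Cmod x0).
  set (B := 4 * S0 * (1 + S0) / (Cmod x0 * Cmod (1 - x0)) + 2 / Cmod x0).
  assert (HBa : 0 < 4 * S0 * (1 + S0) / (Cmod x0 * Cmod (1 - x0))).
  { unfold S0. apply Rdiv_lt_0_compat; [nra | apply Rmult_lt_0_compat; assumption]. }
  assert (HBb : 0 < 2 / Cmod x0) by (apply Rdiv_lt_0_compat; lra).
  assert (HB : 0 < B) by (unfold B; lra).
  set (lo := Cmod (1 - x0) / 2 / (1 + S0)).
  assert (Hlo : 0 < lo) by (unfold lo, S0; apply Rdiv_lt_0_compat; lra).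
  (* The two factors bound (1 + e s)^p and s^q on the disc; in the latter |x / x0| lies in
     [1/2, 2]. *)
  set (A := exp (Cmod p * (Rabs (ln lo) + Rabs (ln (1 + S0)) + PI)) *
            exp (Cmod q * (Cmod (Clog x0) + (Rabs (ln (1 / 2)) + Rabs (ln 2) + PI)))).
  assert (HA : 0 < A) by (apply Rmult_lt_0_compat; apply exp_pos).
  assert (Hdisc : forall x, Cmod (x - x0) < r1 -> Cmod (x - x0) < Cmod x0 / 2 ->
    Cmod (x - x0) < Cmod (1 - x0) / 2 ->
    cut_plane (x / x0) /\ (Cexp (L x) ^ 2)%C = x /\ cut_plane (1 + e * Cexp (L x)) /\
    / (Cmod (1 + e * Cexp (L x)) * Cmod (Cexp (L x))) <= B /\ / (Cmod (Cexp (L x)) ^ 2) <= B /\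
    Cmod (branch_fun e L p q x) <= A).
  { intros x Hx1 Hx2 Hx3.
    pose proof (Cmod_triangle x (x0 - x)) as T1. replace (x + (x0 - x))%C with x0 in T1 by ring.
    pose proof (Cmod_triangle x0 (x - x0)) as T2. replace (x0 + (x - x0))%C with x in T2 by ring.
    pose proof (Cmod_triangle (1 - x) (x - x0)) as T3.
    replace (1 - x + (x - x0))%C with (1 - x0)%C in T3 by ring.
    assert (Esym : Cmod (x0 - x) = Cmod (x - x0)) by (rewrite <- Cmod_opp; f_equal; ring).
    rewrite Esym in T1.
    assert (Hmx : 0 < Cmod x) by lra.
    assert (Hx : x <> 0%C) by (apply Cmod_gt_0, Hmx).
    assert (Hratio : Cmod ((x - x0) / x0) < / 2).
    { rewrite Cmod_div by exact H0. apply Rmult_lt_reg_r with (Cmod x0); [exact Hm0|].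
      unfold Rdiv. rewrite Rmult_assoc, Rinv_l by lra. lra. }
    assert (Exx : (x / x0 = 1 + (x - x0) / x0)%C) by (field; exact H0).
    assert (Hcut : cut_plane (x / x0)) by (rewrite Exx; apply cut_plane_one_plus; lra).
    pose proof (Cexp_local_log_sqrt x0 x H0 Hx) as Hsq. fold L in Hsq.
    set (s := Cexp (L x)) in *.
    assert (Hms : Cmod s * Cmod s = Cmod x).
    { rewrite <- Hsq, Cmod_pow. ring. }
    pose proof (Cmod_ge_0 s) as Hs0.
    assert (Hs1 : 0 < Cmod s) by nra.
    assert (HsS : Cmod s <= S0) by (unfold S0; nra).
    assert (Hcut2 : cut_plane (1 + e * s)).
    { apply cut_plane_one_plus_sqrt. replace ((e * s) ^ 2)%C with x; [apply Hslit, Hx1|].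
      rewrite <- Hsq. simpl. rewrite !Cmult_1_r.
      transitivity ((e * e) * (s * s))%C; [rewrite He|]; ring. }
    pose proof (cut_plane_neq_0 _ Hcut2) as Hn2.
    assert (Hw : 0 < Cmod (1 + e * s)) by (apply Cmod_gt_0, Hn2).
    assert (Hprod : Cmod (1 + e * s) * Cmod (1 - e * s) = Cmod (1 - x)).
    { rewrite <- Cmod_mult. f_equal. rewrite <- Hsq. simpl.
      transitivity (1 - (e * e) * (s * s))%C; [|rewrite He]; ring. }
    assert (Hu1 : Cmod (1 + e * s) <= 1 + S0).
    { eapply Rle_trans; [apply Cmod_triangle|]. rewrite Cmod_1, Cmod_mult, Hme. lra. }
    assert (Hu2 : Cmod (1 - e * s) <= 1 + S0).
    { eapply Rle_trans; [apply Cmod_triangle|]. rewrite Cmod_1, Cmod_opp, Cmod_mult, Hme. lra. }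
    assert (HS : 0 < 1 + S0) by (unfold S0; lra).
    assert (Hlow : lo <= Cmod (1 + e * s)).
    { unfold lo. apply Rmult_le_reg_r with (1 + S0); [exact HS|].
      unfold Rdiv at 1. rewrite Rmult_assoc, Rinv_l, Rmult_1_r by lra.
      apply Rle_trans with (Cmod (1 - x)); [lra|]. rewrite <- Hprod.
      apply Rmult_le_compat_l; lra. }
    repeat split; auto.
    - apply Rle_trans with (4 * S0 * (1 + S0) / (Cmod x0 * Cmod (1 - x0))); [|unfold B; lra].
      assert (Hs2 : Cmod x0 / 2 / S0 <= Cmod s).
      { apply Rmult_le_reg_r with S0; [unfold S0; lra|].
        unfold Rdiv at 1. rewrite Rmult_assoc, Rinv_l, Rmult_1_r by (unfold S0; lra). nra. }
      assert (Hq : 0 < Cmod x0 / 2 / S0) by (unfold S0; apply Rdiv_lt_0_compat; lra).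
      replace (4 * S0 * (1 + S0) / (Cmod x0 * Cmod (1 - x0))) with (/ (lo * (Cmod x0 / 2 / S0))).
      + apply Rinv_le_contravar; [apply Rmult_lt_0_compat; assumption|].
        apply Rmult_le_compat; lra.
      + unfold lo. field. unfold S0; repeat split; lra.
    - apply Rle_trans with (2 / Cmod x0); [|unfold B; lra].
      replace (2 / Cmod x0) with (/ (Cmod x0 / 2)) by (field; lra).
      apply Rinv_le_contravar; [lra|]. simpl. lra.
    - unfold branch_fun. fold s. rewrite Cexp_plus, Cmod_mult.
      apply Rmult_le_compat; try apply Cmod_ge_0.
      + apply Cmod_Cexp_mult_Clog_le; auto.
      + rewrite Cmod_Cexp.
        assert (Hle : Re (q * L x) <= Cmod q * (Cmod (Clog x0) + (Rabs (ln (1 / 2)) + Rabs (ln 2) + PI))).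
        { eapply Rle_trans; [apply Re_le_Cmod|]. rewrite Cmod_mult.
          apply Rmult_le_compat_l; [apply Cmod_ge_0|].
          unfold L, local_log_sqrt. rewrite Cmod_mult, Cmod_inv, Cmod_R, Rabs_right
            by (try apply RtoC_neq_0; lra).
          pose proof (Cmod_triangle (Clog x0) (Clog (x / x0))).
          pose proof (Cmod_ge_0 (Clog x0 + Clog (x / x0))).
          apply Rle_trans with (Cmod (Clog x0 + Clog (x / x0))); [lra|].
          eapply Rle_trans; [apply Cmod_triangle|]. apply Rplus_le_compat_l.
          eapply Rle_trans; [apply Cmod_Clog_le|]. apply Rplus_le_compat_r.
          apply Rabs_ln_le; [lra|]. rewrite Cmod_div by exact H0.
          split; (apply Rmult_le_reg_r with (Cmod x0); [exact Hm0|];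
            unfold Rdiv; rewrite ?(Rmult_assoc (Cmod x)), ?Rinv_l by lra; lra). }
        destruct Hle as [H|H]; [left; apply exp_increasing, H | rewrite H; lra]. }
  (* The first three radii keep the disc within the reach of [Hdisc]; the last makes (|h| B)^n at
     most 2^(-n). *)
  set (r := Rmin (Rmin r1 (Cmod x0 / 2)) (Rmin (Cmod (1 - x0) / 2) (/ (2 * B)))).
  assert (Hr : 0 < r).
  { unfold r. repeat apply Rmin_pos; try lra. apply Rinv_0_lt_compat; lra. }
  assert (Hrs : r <= r1 /\ r <= Cmod x0 / 2 /\ r <= Cmod (1 - x0) / 2 /\ r <= / (2 * B)).
  { unfold r. pose proof (Rmin_l (Rmin r1 (Cmod x0 / 2)) (Rmin (Cmod (1 - x0) / 2) (/ (2 * B)))).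
    pose proof (Rmin_r (Rmin r1 (Cmod x0 / 2)) (Rmin (Cmod (1 - x0) / 2) (/ (2 * B)))).
    pose proof (Rmin_l r1 (Cmod x0 / 2)). pose proof (Rmin_r r1 (Cmod x0 / 2)).
    pose proof (Rmin_l (Cmod (1 - x0) / 2) (/ (2 * B))).
    pose proof (Rmin_r (Cmod (1 - x0) / 2) (/ (2 * B))). lra. }
  destruct Hrs as [Hrs1 [Hrs2 [Hrs3 Hrs4]]].
  exists (fun n => branch_deriv e L n p q x0 / INR (fact n))%C, r. split; [exact Hr|].
  intros y Hy. set (h := (y - x0)%C) in *.
  set (g := fun n (t : R) => (h ^ n * branch_deriv e L n p q (x0 + t * h))%C).
  assert (Hin : forall t, 0 <= t <= 1 -> Cmod (x0 + t * h - x0) < r).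
  { intros t Ht. replace (x0 + t * h - x0)%C with (t * h)%C by ring.
    rewrite Cmod_mult, Cmod_R, Rabs_right by lra. pose proof (Cmod_ge_0 h). nra. }
  assert (Hd : forall n t, 0 <= t <= 1 -> path_derive (g n) t (g (S n) t)).
  { intros n t Ht. specialize (Hin t Ht).
    destruct (Hdisc (x0 + t * h)%C) as [D1 [D2 [D3 _]]]; try lra.
    eapply path_derive_eq.
    - apply path_derive_scal. apply (path_derive_branch_deriv e L (fun s => (x0 + s * h)%C)).
      + apply path_derive_local_log_sqrt; [exact H0 | exact D1].
      + exact D2.
      + exact D3.
    - unfold g. cbn [Cpow]. ring. }
  set (K := (Cmod p + Cmod q) / 2 + 1).
  assert (HK : 0 < K) by (unfold K; pose proof (Cmod_ge_0 p); pose proof (Cmod_ge_0 q); lra).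
  assert (HBd : forall N t, 0 <= t <= 1 -> (1 - t) ^ N / INR (fact N) * Cmod (g (S N) t) <=
     A * (Rrising K (S N) * (/ 2) ^ S N / INR (fact N))).
  { intros N t Ht. specialize (Hin t Ht).
    destruct (Hdisc (x0 + t * h)%C) as [D1 [D2 [D3 [D4 [D5 D6]]]]]; try lra.
    pose proof (Cmod_branch_deriv_le e L (x0 + t * h)%C B K (S N) p q Hme
      (cut_plane_neq_0 _ D3) D4 D5 ltac:(unfold K; lra)) as Hb.
    unfold g. rewrite Cmod_mult, Cmod_pow.
    pose proof (INR_fact_lt_0 N) as Hf. pose proof (Rrising_pos K (S N) HK) as HRp.
    assert (Hh : Cmod h ^ S N * B ^ S N <= (/ 2) ^ S N).
    { rewrite <- Rpow_mult_distr. apply pow_incr. split.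
      - apply Rmult_le_pos; [apply Cmod_ge_0 | lra].
      - apply Rle_trans with (/ (2 * B) * B); [apply Rmult_le_compat_r; lra|].
        right. field. lra. }
    assert (Hh0 : 0 <= Cmod h ^ S N) by apply pow_le, Cmod_ge_0.
    assert (HBp : 0 < B ^ S N) by apply pow_lt, HB.
    assert (Hb2 : Cmod h ^ S N * Cmod (branch_deriv e L (S N) p q (x0 + t * h)) <=
      A * ((/ 2) ^ S N) * Rrising K (S N)).
    { eapply Rle_trans; [apply Rmult_le_compat_l; [exact Hh0 | exact Hb]|].
      replace (Cmod h ^ S N * (Cmod (branch_fun e L p q (x0 + t * h)) * B ^ S N * Rrising K (S N)))
        with (Cmod (branch_fun e L p q (x0 + t * h)) * (Cmod h ^ S N * B ^ S N) * Rrising K (S N))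
        by ring.
      apply Rmult_le_compat_r; [lra|]. apply Rmult_le_compat; auto; [apply Cmod_ge_0|].
      apply Rmult_le_pos; lra. }
    assert (Hp1 : 0 <= (1 - t) ^ N <= 1).
    { split; [apply pow_le; lra|]. rewrite <- (pow1 N) at 2. apply pow_incr; lra. }
    set (X := Cmod h ^ S N * Cmod (branch_deriv e L (S N) p q (x0 + t * h))) in *.
    assert (HX : 0 <= X) by (apply Rmult_le_pos; [exact Hh0 | apply Cmod_ge_0]).
    replace ((1 - t) ^ N / INR (fact N) * X) with (((1 - t) ^ N * X) / INR (fact N)) by (field; lra).
    replace (A * (Rrising K (S N) * (/ 2) ^ S N / INR (fact N)))
      with ((A * (/ 2) ^ S N * Rrising K (S N)) / INR (fact N)) by (field; lra).
    apply Rmult_le_compat_r; [left; apply Rinv_0_lt_compat, Hf|]. nra. }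
  apply is_pseries_C. intros eps Heps.
  assert (Hlim : is_lim_seq (fun n => Rrising K (S n) * (/ 2) ^ S n / INR (fact n)) 0).
  { apply Rrising_geometric_lim; lra. }
  apply is_lim_seq_spec in Hlim.
  assert (He' : 0 < eps / (3 * A)) by (apply Rdiv_lt_0_compat; lra).
  destruct (Hlim (mkposreal _ He')) as [N HN]. exists N. intros n Hn.
  specialize (HN n Hn). simpl pos in HN. rewrite Rminus_0_r in HN. apply Rabs_def2 in HN.
  destruct HN as [HN _].
  pose proof (taylor_remainder_bound g n _ Hd (HBd n)) as HT.
  apply Rle_lt_trans with (2 * (A * (eps / (3 * A)))).
  - eapply Rle_trans; [|apply Rle_trans with (1 := HT); apply Rmult_le_compat_l; [lra|];
      apply Rmult_le_compat_l; lra].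
    right. f_equal. f_equal.
    + apply Csum_ext. intros k _. unfold g. rewrite Cmult_0_l, Cplus_0_r.
      field. apply INR_fact_C_neq_0.
    + unfold g. cbn [branch_deriv Cpow]. rewrite !Cmult_1_l. f_equal. f_equal. unfold h. ring.
  - replace (2 * (A * (eps / (3 * A)))) with (2 / 3 * eps) by (field; lra). lra.
Qed.

(** * The identity theorem on the slit plane *)

Lemma pseries_terms_bounded (u : nat -> C) (x l : C) :
  @is_pseries C_AbsRing C_NormedModule u x l ->
  exists M, 0 < M /\ forall n, Cmod (x ^ n * u n) <= M.
Proof.
  intros H. pose proof (proj1 (is_pseries_C _ _ _) H) as H'. destruct (H' 1 Rlt_0_1) as [N HN].
  assert (Hfin : forall m, exists M, 0 < M /\ forall n, (n <= m)%nat -> Cmod (x ^ n * u n) <= M).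
  { induction m as [|m [M [HM0 HM]]].
    - exists (Cmod (x ^ 0 * u 0%nat) + 1). pose proof (Cmod_ge_0 (x ^ 0 * u 0%nat)).
      split; [lra|]. intros n Hn. replace n with 0%nat by lia. lra.
    - exists (M + Cmod (x ^ S m * u (S m))). pose proof (Cmod_ge_0 (x ^ S m * u (S m))).
      split; [lra|]. intros n Hn. destruct (Nat.eq_dec n (S m)) as [->|Hne]; [lra|].
      specialize (HM n ltac:(lia)). lra. }
  destruct (Hfin N) as [M [HM0 HM]]. exists (M + 2). split; [lra|]. intros n.
  destruct (le_lt_dec n N) as [Hn|Hn]; [specialize (HM n Hn); lra|].
  destruct n as [|n]; [lia|].
  pose proof (HN n ltac:(lia)) as H1. pose proof (HN (S n) ltac:(lia)) as H2.
  rewrite Csum_S in H2. set (S := Csum _ n) in *. set (a := (x ^ Datatypes.S n * u (Datatypes.S n))%C) in *.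
  pose proof (Cmod_triangle (S + a - l) (- (S - l))) as T. rewrite Cmod_opp in T.
  replace (S + a - l + - (S - l))%C with a in T by ring. lra.
Qed.

(** Boundedness of the terms at radius rho gives |u_k| <= M / rho^k; the tail is then dominated by a
    geometric series of ratio q <= 1/2. *)
Lemma pseries_tail_bound (u : nat -> C) (y : C) (rho M : R) n :
  0 < rho -> (forall k, Cmod (RtoC rho ^ k * u k) <= M) -> Cmod y <= rho / 2 ->
  Cmod (Csum (fun k => y ^ k * u k)%C n - u 0%nat) <= 2 * M * (Cmod y / rho).
Proof.
  intros Hr HM Hy. set (q := Cmod y / rho).
  pose proof (Cmod_ge_0 y) as Hy0.
  assert (Hq : 0 <= q <= / 2).
  { unfold q. split.
    - apply Rmult_le_pos; [exact Hy0 | left; apply Rinv_0_lt_compat, Hr].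
    - apply Rmult_le_reg_r with rho; [exact Hr|]. unfold Rdiv. rewrite Rmult_assoc, Rinv_l by lra. lra. }
  assert (HM0 : 0 <= M) by (eapply Rle_trans; [apply Cmod_ge_0 | apply (HM 0%nat)]).
  (* The subtracted term closes the induction: for q <= 1/2, q^(n+1) <= 2 q^(n+1) - 2 q^(n+2). *)
  assert (H : Cmod (Csum (fun k => y ^ k * u k)%C n - u 0%nat) <= M * (2 * q - 2 * q ^ S n)).
  { induction n as [|n IH].
    - rewrite Csum_0. simpl. replace (1 * u 0%nat - u 0%nat)%C with (RtoC 0) by ring.
      rewrite Cmod_0. apply Req_le. ring.
    - rewrite Csum_S. set (S := Csum _ n) in *.
      assert (Ht : Cmod (y ^ Datatypes.S n * u (Datatypes.S n)) <= M * q ^ Datatypes.S n).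
      { specialize (HM (Datatypes.S n)). rewrite Cmod_mult, Cmod_pow, Cmod_R, Rabs_right in HM by lra.
        rewrite Cmod_mult, Cmod_pow.
        replace (Cmod y) with (q * rho) by (unfold q; field; lra).
        rewrite Rpow_mult_distr. assert (0 <= q ^ Datatypes.S n) by (apply pow_le; lra). nra. }
      replace (S + y ^ Datatypes.S n * u (Datatypes.S n) - u 0%nat)%C
        with ((S - u 0%nat) + y ^ Datatypes.S n * u (Datatypes.S n))%C by ring.
      eapply Rle_trans; [apply Cmod_triangle|].
      assert (0 <= q ^ Datatypes.S n) by (apply pow_le; lra).
      change (q ^ Datatypes.S (Datatypes.S n)) with (q * q ^ Datatypes.S n).
      set (X := q ^ Datatypes.S n) in *. assert (q * X <= / 2 * X) by (apply Rmult_le_compat_r; lra).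
      assert (M * (q * X) <= M * (/ 2 * X)) by (apply Rmult_le_compat_l; lra). lra. }
  assert (0 <= q ^ S n) by (apply pow_le; lra).
  assert (0 <= M * q ^ S n) by (apply Rmult_le_pos; lra). lra.
Qed.

(** The sum is only prescribed off 0, so that the lemma can be reapplied to the quotient (f y - u_0)
    / y, whose value at 0 is meaningless. *)
Lemma pseries_zeros_coef_0 (u : nat -> C) (f : C -> C) (r : R) :
  0 < r ->
  (forall y : C, y <> 0%C -> Cmod y < r -> @is_pseries C_AbsRing C_NormedModule u y (f y)) ->
  (forall eps, 0 < eps -> exists y : C, y <> 0%C /\ Cmod y < eps /\ f y = 0%C) ->
  u 0%nat = 0%C.
Proof.
  intros Hr Hf Hz. destruct (Ceq_dec (u 0%nat) 0) as [E|E]; [exact E | exfalso].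
  apply Cmod_gt_0 in E. set (U := Cmod (u 0%nat)) in *.
  set (rho := r / 2).
  destruct (pseries_terms_bounded u rho (f rho)) as [M [HM0 HM]].
  { apply Hf; [apply RtoC_neq_0; unfold rho; lra|]. rewrite Cmod_R, Rabs_right; unfold rho; lra. }
  assert (Hrho : 0 < rho) by (unfold rho; lra).
  (* The second bound makes the tail 2 M |y| / rho at most U/4; a partial sum within U/4 of f y = 0
     then contradicts |u_0| = U. *)
  set (eps := Rmin (rho / 2) (rho * U / (8 * M))).
  assert (He : 0 < eps).
  { apply Rmin_pos; [lra|]. apply Rdiv_lt_0_compat; [nra | lra]. }
  destruct (Hz eps He) as [y [Hy0 [Hy Hfy]]].
  pose proof (Rmin_l (rho / 2) (rho * U / (8 * M))) as E1.
  pose proof (Rmin_r (rho / 2) (rho * U / (8 * M))) as E2. fold eps in E1, E2.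
  assert (Hs := Hf y Hy0 ltac:(unfold rho in *; lra)). rewrite Hfy in Hs.
  pose proof (proj1 (is_pseries_C _ _ _) Hs) as Hs'. destruct (Hs' (U / 4) ltac:(lra)) as [N HN].
  specialize (HN N (Nat.le_refl N)).
  pose proof (pseries_tail_bound u y rho M N Hrho HM ltac:(lra)) as HT.
  set (S := Csum _ N) in *.
  assert (HU : U <= Cmod (S - 0) + Cmod (S - u 0%nat)).
  { unfold U. rewrite <- (Cmod_opp (S - u 0%nat)).
    replace (u 0%nat) with ((S - 0) + - (S - u 0%nat))%C at 1 by ring. apply Cmod_triangle. }
  assert (Hq : 2 * M * (Cmod y / rho) <= U / 4).
  { replace (U / 4) with (2 * M * ((rho * U / (8 * M)) / rho)) by (field; lra).
    apply Rmult_le_compat_l; [lra|]. apply Rmult_le_compat_r; [left; apply Rinv_0_lt_compat, Hrho | lra]. }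
  lra.
Qed.

Lemma is_pseries_C_shift (u : nat -> C) (y l : C) :
  y <> 0%C -> @is_pseries C_AbsRing C_NormedModule u y l ->
  @is_pseries C_AbsRing C_NormedModule (fun n => u (S n)) y ((l - u 0%nat) / y)%C.
Proof.
  intros Hy H.
  pose proof (is_pseries_decr_1 (V := C_NormedModule) u y (/ y)%C l (Cinv_l y Hy) H) as E.
  unfold Cdiv. rewrite Cmult_comm. exact E.
Qed.

(** Once u_0 = 0, dividing by y shifts the series and keeps the zeros, so the induction varies [u]
    and [f]. *)
Lemma pseries_zeros_coefs (n : nat) : forall (u : nat -> C) (f : C -> C) (r : R),
  0 < r ->
  (forall y : C, y <> 0%C -> Cmod y < r -> @is_pseries C_AbsRing C_NormedModule u y (f y)) ->
  (forall eps, 0 < eps -> exists y : C, y <> 0%C /\ Cmod y < eps /\ f y = 0%C) ->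
  u n = 0%C.
Proof.
  induction n as [|n IH]; intros u f r Hr Hf Hz.
  - exact (pseries_zeros_coef_0 u f r Hr Hf Hz).
  - pose proof (pseries_zeros_coef_0 u f r Hr Hf Hz) as H0.
    apply (IH (fun k => u (S k)) (fun y => (f y - u 0%nat) / y)%C r Hr).
    + intros y Hy Hyr. apply is_pseries_C_shift; auto.
    + intros eps He. destruct (Hz eps He) as [y [Hy [Hye Hfy]]]. exists y.
      repeat split; auto. rewrite Hfy, H0. unfold Cdiv. ring.
Qed.

Lemma analytic_zeros_cluster (F : C -> C) (x : C) :
  analytic_at F x ->
  (forall eps, 0 < eps -> exists y, y <> x /\ Cmod (y - x) < eps /\ F y = 0%C) ->
  exists r, 0 < r /\ forall y, Cmod (y - x) < r -> F y = 0%C.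
Proof.
  intros [u [r [Hr Hu]]] Hz. exists r. split; [exact Hr|]. intros y Hy.
  assert (H0 : forall n, u n = 0%C).
  { intros n. apply (pseries_zeros_coefs n u (fun h => F (x + h)%C) r Hr).
    - intros h _ Hh. replace h with (x + h - x)%C at 1 by ring.
      apply Hu. replace (x + h - x)%C with h by ring. exact Hh.
    - intros eps He. destruct (Hz eps He) as [w [Hw [Hwe HFw]]].
      exists (w - x)%C. repeat split.
      + intros E. apply Hw, Ceq_minus, E.
      + exact Hwe.
      + replace (x + (w - x))%C with w by ring. exact HFw. }
  apply (is_pseries_C_unique _ _ _ _ (Hu y Hy)). apply is_pseries_C.
  intros eps He. exists 0%nat. intros n _.
  rewrite Csum_zero by (intros k _; rewrite H0; ring).
  replace (0 - 0)%C with (RtoC 0) by ring. rewrite Cmod_0. exact He.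
Qed.

(** Plays the part of connectedness of a segment. The supremum T of the t with [P] on [0, t) is
    positive because of [d0], and the step at T passes beyond it unless T = 1. *)
Lemma real_induction (P : R -> Prop) (d0 : R) :
  0 < d0 -> (forall t, 0 <= t < d0 -> P t) ->
  (forall t, 0 < t <= 1 -> (forall s, 0 <= s < t -> P s) ->
    exists d, 0 < d /\ forall s, Rabs (s - t) < d -> P s) ->
  P 1.
Proof.
  intros Hd0 HP0 Hstep.
  set (E := fun t => t <= 1 /\ forall s, 0 <= s < t -> P s).
  destruct (completeness E) as [T [Hub Hlub]].
  - exists 1. intros t [Ht _]. exact Ht.
  - exists 0. split; [lra | intros s Hs; lra].
  - assert (HT1 : T <= 1) by (apply Hlub; intros t [Ht _]; exact Ht).
    assert (HT0 : 0 < T).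
    { apply Rlt_le_trans with (Rmin d0 1); [apply Rmin_pos; lra|]. apply Hub.
      split; [apply Rmin_r|]. intros s Hs. apply HP0.
      pose proof (Rmin_l d0 1). lra. }
    assert (HTP : forall s, 0 <= s < T -> P s).
    { intros s Hs. destruct (classic (exists t, E t /\ s < t)) as [[t [[_ Ht] Hst]]|Hn].
      - apply Ht; lra.
      - exfalso. assert (T <= s); [|lra]. apply Hlub. intros t Ht.
        apply Rnot_lt_le. intros Hlt. apply Hn. exists t; auto. }
    destruct (Hstep T (conj HT0 HT1) HTP) as [d [Hd HdP]].
    destruct (Rlt_dec T 1) as [Hlt|Hge].
    + exfalso. assert (Rmin 1 (T + d) <= T).
      { apply Hub. split; [apply Rmin_l|]. intros s Hs.
        destruct (Rlt_dec s T); [apply HTP; lra|]. apply HdP.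
        pose proof (Rmin_r 1 (T + d)). apply Rabs_def1; lra. }
      assert (T < Rmin 1 (T + d)) by (apply Rmin_glb_lt; lra). lra.
    + apply HdP. replace (1 - T) with 0 by lra. rewrite Rabs_R0. exact Hd.
Qed.

Lemma slit_plane_star (x : C) (t : R) : 0 <= t <= 1 -> slit_plane x -> slit_plane (t * x).
Proof.
  intros Ht Hx [H1 H2]. rewrite im_scal_l in H1. rewrite re_scal_l in H2.
  apply Hx. assert (t <> 0) by (intros ->; lra). split; nra.
Qed.

Lemma analytic_at_minus (F G : C -> C) (x : C) :
  analytic_at F x -> analytic_at G x -> analytic_at (fun y => F y - G y)%C x.
Proof.
  intros [u [r [Hr Hu]]] [v [r' [Hr' Hv]]].
  exists (fun n => u n + -1 * v n)%C, (Rmin r r'). split; [apply Rmin_pos; assumption|].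
  intros y Hy. pose proof (Rmin_l r r'). pose proof (Rmin_r r r').
  replace (F y - G y)%C with (F y + -1 * G y)%C by ring.
  apply is_pseries_C_plus; [apply Hu; lra | apply is_pseries_C_scal, Hv; lra].
Qed.

(** Along the ray t x the difference vanishes for t < 1/|x|. If it vanishes before t, these zeros
    accumulate at t x, so it vanishes on a disc around t x and hence slightly beyond. *)
Lemma analytic_identity_slit_plane (F G : C -> C) :
  (forall x, slit_plane x -> analytic_at F x) ->
  (forall x, slit_plane x -> analytic_at G x) ->
  (forall x, Cmod x < 1 -> F x = G x) ->
  forall x, slit_plane x -> F x = G x.
Proof.
  intros HF HG Heq x Hx. destruct (Ceq_dec x 0) as [->|Hx0].
  { apply Heq. rewrite Cmod_0; lra. }
  assert (Hm : 0 < Cmod x) by (apply Cmod_gt_0, Hx0).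
  apply Ceq_minus. replace x with (RtoC 1 * x)%C by ring.
  apply (real_induction (fun t => (F (t * x) - G (t * x) = 0)%C) (/ Cmod x)).
  - apply Rinv_0_lt_compat, Hm.
  - intros t Ht. apply (proj1 (Ceq_minus _ _)), Heq. rewrite Cmod_mult, Cmod_R, Rabs_right by lra.
    apply Rmult_lt_reg_r with (/ Cmod x); [apply Rinv_0_lt_compat, Hm|].
    rewrite Rmult_assoc, Rinv_r by lra. lra.
  - intros t Ht HP.
    destruct (analytic_zeros_cluster (fun y => F y - G y)%C (t * x)) as [r [Hr Hz]].
    + assert (slit_plane (t * x)) by (apply slit_plane_star; [lra | exact Hx]).
      apply analytic_at_minus; auto.
    (* The nearby zero is (t - d) x: d <= t/2 keeps its parameter in [0, t), and the other bound
       puts it within eps of t x. *)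
    + intros eps He. set (d := Rmin (t / 2) (eps / (2 * Cmod x))).
      assert (Hd : 0 < d) by (apply Rmin_pos; [lra | apply Rdiv_lt_0_compat; lra]).
      pose proof (Rmin_l (t / 2) (eps / (2 * Cmod x))) as E1.
      pose proof (Rmin_r (t / 2) (eps / (2 * Cmod x))) as E2. fold d in E1, E2.
      assert (Edx : Cmod (RtoC (t - d) * x - t * x) = d * Cmod x).
      { rewrite RtoC_minus. replace ((t - d) * x - t * x)%C with (- (d * x))%C by ring.
        rewrite Cmod_opp, Cmod_mult, Cmod_R, Rabs_right by lra. reflexivity. }
      exists (RtoC (t - d) * x)%C. repeat split.
      * intros E. rewrite E in Edx. replace (t * x - t * x)%C with (RtoC 0) in Edx by ring.
        rewrite Cmod_0 in Edx. nra.
      * rewrite Edx. apply Rle_lt_trans with (eps / (2 * Cmod x) * Cmod x).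
        -- apply Rmult_le_compat_r; lra.
        -- replace (eps / (2 * Cmod x) * Cmod x) with (eps / 2) by (field; lra). lra.
      * apply HP. lra.
    + exists (r / Cmod x). split; [apply Rdiv_lt_0_compat; assumption|].
      intros s Hs. apply Hz. replace (s * x - t * x)%C with (RtoC (s - t) * x)%C
        by (rewrite RtoC_minus; ring).
      rewrite Cmod_mult, Cmod_R. apply Rmult_lt_reg_r with (/ Cmod x); [apply Rinv_0_lt_compat, Hm|].
      rewrite Rmult_assoc, Rinv_r by lra. unfold Rdiv in Hs. lra.
Qed.

(** * The coefficient identity *)

(* Up to sign, the coefficients of [(1/z d/dz)^m]; they are also those of the Bessel
   polynomials. *)
Fixpoint bessel_coef (m k : nat) : R :=
  match m, k with
  | O, O => 1
  | O, S _ => 0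
  | S _, O => 0
  | S m', S k' => bessel_coef m' k' + (2 * INR m' - INR k) * bessel_coef m' k
  end.

Lemma bessel_coef_gt m : forall k, (m < k)%nat -> bessel_coef m k = 0.
Proof.
  induction m as [|m IH]; intros [|k] H; try lia; simpl; [reflexivity|].
  rewrite !IH by lia. ring.
Qed.

(** [d] stands for n - j, avoiding truncated subtraction. The boundary cases of the recursion are j
    = 0, where the first term drops for positive [m'], and d = 0, where the second vanishes. *)
Lemma bessel_coef_closed n : forall j d, (j + d)%nat = n ->
  bessel_coef (S n) (S j) =
  INR (fact (j + 2 * d)) / (INR (fact j) * INR (fact d) * 2 ^ d).
Proof.
  induction n as [|n IH]; intros j d Hn.
  - assert (j = 0%nat) by lia. assert (d = 0%nat) by lia. subst. simpl. field.
  - change (bessel_coef (S (S n)) (S j)) with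
      (bessel_coef (S n) j + (2 * INR (S n) - INR (S j)) * bessel_coef (S n) (S j)).
    assert (H2 : forall d, 2 ^ d <> 0) by (intros; apply pow_nonzero; lra).
    destruct j as [|j].
    + destruct d as [|d]; [lia|]. rewrite (IH 0%nat d) by lia.
      assert (n = d) by lia. subst n. simpl (bessel_coef (S d) 0).
      replace (0 + 2 * S d)%nat with (S (S (0 + 2 * d))) by lia.
      rewrite !fact_simpl, !mult_INR, !S_INR, plus_INR, mult_INR. cbn [pow fact].
      simpl (INR 0). change (INR 2) with 2. change (INR 1) with 1.
      field. repeat split; auto using INR_fact_neq_0.
      pose proof (pos_INR d); lra.
    + destruct d as [|d].
      * rewrite (bessel_coef_gt (S n) (S (S j))) by lia. rewrite (IH j 0%nat) by lia.
        replace (j + 2 * 0)%nat with j by lia. replace (S j + 2 * 0)%nat with (S j) by lia.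
        simpl pow. simpl (INR (fact 0)). field. split; apply INR_fact_neq_0.
      * rewrite (IH j (S d)), (IH (S j) d) by lia.
        assert (n = j + S d)%nat by lia. subst n.
        replace (S j + 2 * S d)%nat with (S (S (S (j + 2 * d)))) by lia.
        replace (j + 2 * S d)%nat with (S (S (j + 2 * d))) by lia.
        replace (S j + 2 * d)%nat with (S (j + 2 * d)) by lia.
        rewrite !fact_simpl, !mult_INR, !S_INR, !plus_INR, !mult_INR, !S_INR. cbn [pow].
        change (INR 2) with 2. change (INR 0) with 0.
        pose proof (pos_INR j). pose proof (pos_INR d).
        field. repeat split; auto using INR_fact_neq_0; lra.
Qed.

Lemma odd_product_fact d : odd_product d * (INR (fact d) * 2 ^ d) = INR (fact (2 * d)).
Proof.
  induction d as [|d IH]; [simpl; ring|].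
  replace (2 * S d)%nat with (S (S (2 * d))) by lia.
  rewrite !fact_simpl, !mult_INR, <- IH, !S_INR, !mult_INR. cbn [odd_product pow].
  rewrite plus_INR, mult_INR. change (INR 2) with 2. change (INR 1) with 1. ring.
Qed.

Lemma odd_dfact_nonneg d : odd_dfact (2 * Z.of_nat d - 1) = odd_product d.
Proof.
  unfold odd_dfact. destruct (Z.leb_spec (-1) (2 * Z.of_nat d - 1)); [|lia].
  replace ((2 * Z.of_nat d - 1 + 1) / 2)%Z with (Z.of_nat d); [rewrite Nat2Z.id; reflexivity|].
  replace (2 * Z.of_nat d - 1 + 1)%Z with (Z.of_nat d * 2)%Z by lia.
  symmetry. apply Z.div_mul. lia.
Qed.

Lemma falling_INR_fact j d :
  (falling (INR (j + d)) j * INR (fact d) = INR (fact (j + d)))%C.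
Proof.
  induction j as [|j IH]; [simpl; ring|].
  rewrite falling_S_l. replace (INR (S j + d) - 1)%C with (RtoC (INR (j + d))).
  - rewrite <- Cmult_assoc, IH. change (S j + d)%nat with (S (j + d)).
    rewrite fact_simpl, mult_INR, RtoC_mult. ring.
  - change (S j + d)%nat with (S (j + d)). rewrite S_INR, RtoC_plus. ring.
Qed.

Lemma odd_dfact_binomial_eq_bessel_coef m k : (k <= m)%nat ->
  (odd_dfact (2 * Z.of_nat m - 2 * Z.of_nat k - 1) *
   binomial (IZR (2 * Z.of_nat m - Z.of_nat k - 1)) (Z.of_nat k - 1))%C
  = RtoC (bessel_coef m k).
Proof.
  intros Hk. destruct k as [|j].
  - unfold binomial. simpl (0 <=? _)%Z. cbn iota. simpl (_ =? _)%Z. cbn iota.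
    (* Here the lower index is -1 and the upper one 2m - 1, so the convention binom(-1, -1) = 1
       applies exactly for m = 0, in agreement with the first column of [bessel_coef]. *)
    destruct m as [|m].
    + simpl. destruct (Ceq_dec _ _) as [|n]; [|exfalso; apply n; reflexivity].
      unfold odd_dfact. simpl. ring.
    + destruct (Ceq_dec _ _) as [E|_]; [|simpl; ring].
      exfalso. apply RtoC_inj, eq_IZR in E. lia.
  - destruct (Nat.le_exists_sub _ _ Hk) as [d [-> _]].
    replace (d + S j)%nat with (S (j + d)) by lia.
    rewrite (bessel_coef_closed (j + d) j d eq_refl).
    replace (2 * Z.of_nat (S (j + d)) - 2 * Z.of_nat (S j) - 1)%Z with (2 * Z.of_nat d - 1)%Z by lia.
    rewrite odd_dfact_nonneg.
    replace (Z.of_nat (S j) - 1)%Z with (Z.of_nat j) by lia.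
    replace (2 * Z.of_nat (S (j + d)) - Z.of_nat (S j) - 1)%Z with (Z.of_nat (j + 2 * d)) by lia.
    rewrite <- INR_IZR_INZ.
    unfold binomial. destruct (Z.leb_spec 0 (Z.of_nat j)); [|lia]. rewrite Nat2Z.id.
    pose proof (falling_INR_fact j (2 * d)) as E. rewrite <- odd_product_fact in E.
    assert (Hp : odd_product d <> 0).
    { intros E0. pose proof (odd_product_fact d) as E1. rewrite E0, Rmult_0_l in E1.
      symmetry in E1. exact (INR_fact_neq_0 _ E1). }
    assert (H2 : 2 ^ d <> 0) by (apply pow_nonzero; lra).
    pose proof (INR_fact_neq_0 d) as Hd. pose proof (INR_fact_neq_0 j) as Hj.
    rewrite RtoC_div by (repeat apply Rmult_integral_contrapositive_currified; auto).
    rewrite <- E, !RtoC_mult. field. repeat split; apply RtoC_neq_0; auto.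
Qed.

Lemma Csum_shift (g : nat -> C) n : Csum (fun k => g (S k)) n = (Csum g (S n) - g 0%nat)%C.
Proof.
  induction n as [|n IH].
  - rewrite Csum_S, !Csum_0. ring.
  - rewrite Csum_S, IH, (Csum_S g (S n)). ring.
Qed.

Fixpoint even_prod (m : nat) (x : C) : C :=
  match m with
  | O => 1
  | S n => even_prod n x * (2 * INR n - x)
  end%C.

(** Since <x>_(k+1) = <x>_k (x - k), the two terms of the recursion multiply the k-th summand by -(x
    - k) + (2m - k) = 2m - x, which is independent of k. *)
Lemma bessel_coef_falling_sum m (x : C) :
  Csum (fun k => (-1) ^ k * bessel_coef m k * falling x k)%C m = even_prod m x.
Proof.
  induction m as [|m IH]; [rewrite Csum_0; simpl; ring|].
  cbn [even_prod]. rewrite <- IH.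
  set (f := fun k => ((-1) ^ k * bessel_coef m k * falling x k)%C).
  assert (E1 : Csum (fun k => (-1) ^ k * bessel_coef (S m) k * falling x k)%C (S m) =
    Csum (fun k => - ((-1) ^ k * bessel_coef m k * falling x (S k))
                   + (2 * INR m - INR (S k)) * f (S k))%C m).
  { pose proof (Csum_shift (fun k => (-1) ^ k * bessel_coef (S m) k * falling x k)%C m) as E.
    cbv beta in E. change (bessel_coef (S m) 0) with 0 in E. rewrite Cmult_0_r, Cmult_0_l in E.
    replace (Csum _ (S m)) with (Csum (fun k => (-1) ^ k * bessel_coef (S m) k * falling x k)%C (S m) - 0)%C by ring.
    rewrite <- E. apply Csum_ext. intros k _. unfold f.
    change (bessel_coef (S m) (S k)) with
      (bessel_coef m k + (2 * INR m - INR (S k)) * bessel_coef m (S k)).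
    rewrite RtoC_plus, RtoC_mult, RtoC_minus, RtoC_mult. cbn [Cpow]. ring. }
  rewrite E1, Csum_plus.
  rewrite (Csum_shift (fun k => (2 * INR m - INR k) * f k)%C).
  rewrite Csum_S. unfold f at 2. rewrite (bessel_coef_gt m (S m)) by lia.
  (* The term k = 0 lost by the shift is zero: for m = 0 through its factor, for m > 0 through its
     coefficient. *)
  assert (E0 : ((2 * INR m - INR 0) * f 0%nat = 0)%C).
  { unfold f. destruct m; simpl; ring. }
  rewrite E0.
  transitivity (Csum (fun k => - ((-1) ^ k * bessel_coef m k * falling x (S k))
                   + (2 * INR m - INR k) * f k)%C m).
  - rewrite Csum_plus. ring.
  - rewrite (Cmult_comm (Csum _ _)), <- Csum_scal. apply Csum_ext. intros k _. unfold f. cbn [falling]. ring.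
Qed.

(** Replacing x by x + 2 slides the window of factors by one; cross-multiplied to avoid a
    division. *)
Lemma even_prod_shift m (x : C) :
  (even_prod m (x + 2) * (2 * INR m - 2 - x) = even_prod m x * (- 2 - x))%C.
Proof.
  induction m as [|m IH]; [simpl; ring|].
  cbn [even_prod]. rewrite S_INR, RtoC_plus.
  transitivity ((even_prod m (x + 2) * (2 * INR m - 2 - x)) * (2 * INR m - x))%C; [ring|].
  rewrite IH. ring.
Qed.

(** Normalises the coefficient of z, which is why (2m - 3)!! occurs in the prefactor. For m = 0 the
    empty product agrees with (-3)!! = -1. *)
Lemma even_prod_1 m : even_prod m 1 = (- odd_dfact (2 * Z.of_nat m - 3))%C.
Proof.
  destruct m as [|m].
  - unfold odd_dfact. simpl. rewrite <- RtoC_opp. f_equal. field.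
  - replace (2 * Z.of_nat (S m) - 3)%Z with (2 * Z.of_nat m - 1)%Z by lia.
    rewrite odd_dfact_nonneg. induction m as [|m IH]; [simpl; ring|].
    cbn [even_prod odd_product] in *. rewrite IH.
    rewrite plus_INR, mult_INR, S_INR, !RtoC_mult, !RtoC_plus, RtoC_mult. simpl (INR 2). simpl (INR 1).
    rewrite RtoC_plus. ring.
Qed.

Lemma odd_dfact_neq_0 m : odd_dfact (2 * Z.of_nat m - 3) <> 0.
Proof.
  destruct m as [|m].
  - unfold odd_dfact. simpl. lra.
  - replace (2 * Z.of_nat (S m) - 3)%Z with (2 * Z.of_nat m - 1)%Z by lia.
    rewrite odd_dfact_nonneg. intros E. pose proof (odd_product_fact m) as E1.
    rewrite E, Rmult_0_l in E1. symmetry in E1. exact (INR_fact_neq_0 _ E1).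
Qed.

(** Used to keep the half-integers 3/2 - m + j, and with them the denominators (3/2 - m)_j, away
    from 0. *)
Lemma odd_neq_even (i j : nat) : RtoC (2 * INR i) <> RtoC (2 * INR j + 1).
Proof.
  intros E. apply RtoC_inj in E. rewrite !INR_IZR_INZ in E.
  rewrite <- !mult_IZR, <- plus_IZR in E. apply eq_IZR in E. lia.
Qed.

(** Both sides obey the same first-order recurrence in j. Two steps of the falling factorial give
    (-2a - 2j)(-2a - 2j - 1) = 4 (a + j)(a + 1/2 + j), and the factor 2j + 3 from [even_prod_shift]
    cancels against the one in (2j + 3)!. The leading 2 is 1 - (-1)^(2j+1). *)
Lemma odd_coef_eq_hyp2F1_coef (a : C) (m j : nat) : a <> (1 / 2)%C ->
  (1 / (2 * (2 * a - 1)) * (1 / odd_dfact (2 * Z.of_nat m - 3)) *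
   (2 * even_prod m (2 * INR j + 1) *
    (falling (1 - 2 * a) (2 * j + 1) / INR (fact (2 * j + 1)))))%C =
  hyp2F1_coef a (a + 1 / 2) (3 / 2 - INR m) j.
Proof.
  intros Ha.
  assert (Ha' : (2 * a - 1 <> 0)%C).
  { intros E. apply Ha. transitivity ((2 * a - 1) / 2 + 1 / 2)%C; [field|]. rewrite E. field. }
  pose proof (RtoC_neq_0 _ (odd_dfact_neq_0 m)) as Hdf.
  induction j as [|j IH].
  - unfold hyp2F1_coef. replace (2 * INR 0 + 1)%C with (RtoC 1) by (simpl; ring).
    rewrite even_prod_1. change (2 * 0 + 1)%nat with 1%nat.
    cbn [falling rising fact Nat.mul Nat.add INR]. field. auto.
  - set (kappa := (1 / (2 * (2 * a - 1)) * (1 / odd_dfact (2 * Z.of_nat m - 3)))%C) in *.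
    assert (Hc : (3 / 2 - INR m + INR j <> 0)%C).
    { intros E. apply (odd_neq_even m (S j)). rewrite S_INR.
      rewrite !RtoC_plus, !RtoC_mult, RtoC_plus.
      transitivity (2 * INR m + 2 * (3 / 2 - INR m + INR j))%C; [rewrite E; ring | field]. }
    assert (Hstep : hyp2F1_coef a (a + 1 / 2) (3 / 2 - INR m) (S j) =
      (hyp2F1_coef a (a + 1 / 2) (3 / 2 - INR m) j *
       ((a + INR j) * (a + 1 / 2 + INR j) / ((3 / 2 - INR m + INR j) * INR (S j))))%C).
    { unfold hyp2F1_coef. rewrite fact_simpl, mult_INR, RtoC_mult. cbn [rising].
      assert (Hr : (rising (3 / 2 - INR m) j <> 0)%C).
      { clear -m. induction j as [|j IH]; [exact C1_nz|]. cbn [rising].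
        apply Cmult_neq_0; [exact IH|].
        intros E. apply (odd_neq_even m (S j)). rewrite S_INR.
        rewrite !RtoC_plus, !RtoC_mult, RtoC_plus.
        transitivity (2 * INR m + 2 * (3 / 2 - INR m + INR j))%C; [rewrite E; ring | field]. }
      field. repeat split; auto; try apply INR_fact_C_neq_0.
      - apply RtoC_neq_0, not_0_INR; lia.
      - intros E. apply Hc. transitivity ((3 - 2 * INR m + 2 * INR j) / 2)%C; [field|].
        replace (3 - 2 * INR m + 2 * INR j)%C with (RtoC 0) by (rewrite <- E; ring). field. }
    rewrite Hstep, <- IH.
    replace (2 * S j + 1)%nat with (S (S (2 * j + 1))) by lia.
    rewrite !fact_simpl, !mult_INR, !RtoC_mult. cbn [falling].
    assert (Hev : (even_prod m (2 * INR (S j) + 1) * (2 * (INR m - INR j) - 3) =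
      even_prod m (2 * INR j + 1) * (- (2 * INR j + 3)))%C).
    { pose proof (even_prod_shift m (2 * INR j + 1)) as E.
      replace (2 * INR (S j) + 1)%C with (2 * INR j + 1 + 2)%C
        by (rewrite S_INR, RtoC_plus; ring).
      replace (2 * (INR m - INR j) - 3)%C with (2 * INR m - 2 - (2 * INR j + 1))%C by ring.
      rewrite E. ring. }
    assert (Hn : (2 * (INR m - INR j) - 3 <> 0)%C).
    { intros E. apply Hc. transitivity (- (2 * (INR m - INR j) - 3) / 2)%C; [field|].
      rewrite E. field. }
    replace (even_prod m (2 * INR (S j) + 1)) with
      (even_prod m (2 * INR j + 1) * (- (2 * INR j + 3)) / (2 * (INR m - INR j) - 3))%C
      by (rewrite <- Hev; field; exact Hn).
    rewrite !S_INR, !plus_INR, !mult_INR, !RtoC_plus, !RtoC_mult.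
    change (INR 2) with 2. change (INR 1) with 1.
    pose proof (INR_fact_C_neq_0 (2 * j + 1)) as Hf.
    assert (Hj1 : (INR j + 1 <> 0)%C) by (rewrite <- RtoC_plus; apply RtoC_neq_0; pose proof (pos_INR j); lra).
    assert (Hc2 : (3 - 2 * INR m + 2 * INR j <> 0)%C).
    { intros E. apply Hc. transitivity ((3 - 2 * INR m + 2 * INR j) / 2)%C; [field|].
      rewrite E. field. }
    unfold Cdiv at 1. field.
    repeat split; auto.
    + intros E. apply Hc2. rewrite <- E. ring.
    + rewrite <- RtoC_mult, <- !RtoC_plus. apply RtoC_neq_0. pose proof (pos_INR j). lra.
    + rewrite <- RtoC_mult, <- !RtoC_plus. apply RtoC_neq_0. pose proof (pos_INR j). lra.
Qed.

(** * The closed form as the Gauss function *)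

Lemma is_pseries_C_sum (u : nat -> nat -> C) (l : nat -> C) (z : C) m :
  (forall k, (k <= m)%nat -> @is_pseries C_AbsRing C_NormedModule (u k) z (l k)) ->
  @is_pseries C_AbsRing C_NormedModule (fun n => Csum (fun k => u k n) m) z (Csum l m).
Proof.
  induction m as [|m IH]; intros H.
  - rewrite Csum_0. apply is_pseries_C_ext with (u := u 0%nat); [intros n; rewrite Csum_0; reflexivity|].
    apply H. lia.
  - rewrite Csum_S.
    apply is_pseries_C_ext with (u := fun n => (Csum (fun k => u k n) m + u (S m) n)%C).
    { intros n. rewrite Csum_S. reflexivity. }
    apply is_pseries_C_plus; [apply IH; intros; apply H; lia | apply H; lia].
Qed.

Lemma is_pseries_C_incr (u : nat -> C) (z l : C) k :
  @is_pseries C_AbsRing C_NormedModule u z l ->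
  @is_pseries C_AbsRing C_NormedModule
    (fun n => if (k <=? n)%nat then u (n - k)%nat else RtoC 0) z (z ^ k * l)%C.
Proof.
  intros H. induction k as [|k IH].
  - simpl. rewrite Cmult_1_l. apply is_pseries_C_ext with (2 := H).
    intros n. rewrite Nat.sub_0_r. reflexivity.
  - pose proof (is_pseries_incr_1 (V := C_NormedModule) _ _ _ IH) as E.
    cbn [Cpow]. rewrite <- Cmult_assoc. apply is_pseries_C_ext with (2 := E).
    intros [|n]; reflexivity.
Qed.

Lemma is_pseries_C_opp_arg (u : nat -> C) (z l : C) :
  @is_pseries C_AbsRing C_NormedModule u (- z)%C l ->
  @is_pseries C_AbsRing C_NormedModule (fun n => (-1) ^ n * u n)%C z l.
Proof.
  intros H. apply is_pseries_C. intros eps He.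
  destruct (proj1 (is_pseries_C _ _ _) H eps He) as [N HN]. exists N. intros n Hn.
  rewrite (Csum_ext _ (fun k => (- z) ^ k * u k)%C); [apply HN, Hn|].
  intros k _. replace (- z)%C with (-1 * z)%C by ring. rewrite Cpow_mult_l. ring.
Qed.

(** The partial sum up to 2n + 1 in z is z times the partial sum up to n in z^2; dividing by z
    rescales the tolerance by |z|. *)
Lemma is_pseries_C_odd (d : nat -> C) (z l : C) :
  z <> 0%C -> (forall j, d (2 * j)%nat = 0%C) ->
  @is_pseries C_AbsRing C_NormedModule d z (z * l)%C ->
  @is_pseries C_AbsRing C_NormedModule (fun j => d (2 * j + 1)%nat) (z ^ 2)%C l.
Proof.
  intros Hz Hd H. apply is_pseries_C. intros eps He.
  assert (Hm : 0 < Cmod z) by (apply Cmod_gt_0, Hz).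
  assert (He' : 0 < eps * Cmod z) by (apply Rmult_lt_0_compat; assumption).
  destruct (proj1 (is_pseries_C _ _ _) H _ He') as [N HN]. exists N. intros n Hn.
  specialize (HN (2 * n + 1)%nat ltac:(lia)).
  assert (E : forall n, Csum (fun k => z ^ k * d k)%C (2 * n + 1) =
    (z * Csum (fun k => (z ^ 2) ^ k * d (2 * k + 1)%nat) n)%C).
  { clear -Hd. induction n as [|n IH].
    - change (2 * 0 + 1)%nat with 1%nat. pose proof (Hd 0%nat) as E0. change (2 * 0)%nat with 0%nat in E0.
      rewrite Csum_S, !Csum_0, E0. simpl. ring.
    - replace (2 * S n + 1)%nat with (S (S (2 * n + 1))) by lia.
      rewrite (Csum_S _ (S _)), Csum_S, IH, (Csum_S _ n).
      replace (S (2 * n + 1)) with (2 * S n)%nat by lia. rewrite Hd.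
      replace (S (2 * S n)) with (2 * S n + 1)%nat by lia.
      rewrite (Cpow_add_r z (2 * S n) 1), <- Cpow_mult_r, Cpow_1_r. ring. }
  rewrite E in HN. apply Rmult_lt_reg_r with (Cmod z); [exact Hm|].
  rewrite <- Cmod_mult. eapply Rle_lt_trans; [|exact HN]. right. f_equal. ring.
Qed.

Lemma pow_neg_1_sqr k : ((-1) ^ k * (-1) ^ k = 1)%C.
Proof.
  rewrite <- Cpow_mult_l. replace (-1 * -1)%C with (RtoC 1) by ring. apply Cpow_1_l.
Qed.

Lemma rising_opp (p : C) k : rising (- p) k = ((-1) ^ k * falling p k)%C.
Proof. induction k as [|k IH]; [simpl; ring|]. cbn [rising falling Cpow]. rewrite IH. ring. Qed.

Definition bracket (a : C) (k : nat) (z : C) : C :=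
  (rising (2 * a - 1) k * Ccpow (1 + z) (1 - 2 * a - INR k) -
   falling (1 - 2 * a) k * Ccpow (1 - z) (1 - 2 * a - INR k))%C.

Lemma rising_falling (a : C) k :
  rising (2 * a - 1) k = ((-1) ^ k * falling (1 - 2 * a) k)%C.
Proof. rewrite <- rising_opp. f_equal. ring. Qed.

Lemma bracket_opp (a : C) k (z : C) : bracket a k (- z) = ((-1) ^ S k * bracket a k z)%C.
Proof.
  unfold bracket. rewrite rising_falling.
  replace (1 + - z)%C with (1 - z)%C by ring. replace (1 - - z)%C with (1 + z)%C by ring.
  set (X := Ccpow (1 - z) _). set (Y := Ccpow (1 + z) _). set (F := falling _ k). cbn [Cpow].
  transitivity ((-1) ^ k * F * X - ((-1) ^ k * (-1) ^ k) * F * Y)%C;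
    [rewrite pow_neg_1_sqr|]; ring.
Qed.

Lemma bracket_series (a z : C) k :
  Cmod z < 1 \/ (exists q : nat, (1 - 2 * a)%C = INR q) ->
  @is_pseries C_AbsRing C_NormedModule
    (fun n => falling (1 - 2 * a) (n + k) / INR (fact n) * ((-1) ^ k - (-1) ^ n))%C z
    (bracket a k z).
Proof.
  intros H.
  pose proof (binomial_series_shifted (1 - 2 * a) z k H) as H1.
  assert (H' : Cmod (- z) < 1 \/ (exists q : nat, (1 - 2 * a)%C = INR q)) by (rewrite Cmod_opp; exact H).
  pose proof (is_pseries_C_opp_arg _ _ _ (binomial_series_shifted (1 - 2 * a) (- z) k H')) as H2.
  pose proof (is_pseries_C_plus _ _ _ _ _ (is_pseries_C_scal ((-1) ^ k) _ _ _ H1)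
    (is_pseries_C_scal (-1) _ _ _ H2)) as H3.
  replace (bracket a k z) with
    ((-1) ^ k * (falling (1 - 2 * a) k * Ccpow (1 + z) (1 - 2 * a - INR k)) +
     -1 * (falling (1 - 2 * a) k * Ccpow (1 + - z) (1 - 2 * a - INR k)))%C.
  - apply is_pseries_C_ext with (2 := H3). intros n. ring.
  - unfold bracket. rewrite rising_falling. unfold Cminus. ring.
Qed.

Lemma bracket_sum_series (a z : C) m :
  Cmod z < 1 \/ (exists q : nat, (1 - 2 * a)%C = INR q) ->
  @is_pseries C_AbsRing C_NormedModule
    (fun n => even_prod m (INR n) * (falling (1 - 2 * a) n / INR (fact n)) * (1 - (-1) ^ n))%C z
    (Csum (fun k => bessel_coef m k * (z ^ k * bracket a k z))%C m).
Proof.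
  intros H.
  pose proof (is_pseries_C_sum _ _ z m (fun k _ => is_pseries_C_scal (bessel_coef m k) _ _ _
    (is_pseries_C_incr _ _ _ k (bracket_series a z k H)))) as E.
  apply is_pseries_C_ext with (2 := E). clear E. intros n.
  rewrite <- bessel_coef_falling_sum.
  transitivity ((falling (1 - 2 * a) n / INR (fact n) * (1 - (-1) ^ n)) *
    Csum (fun k => (-1) ^ k * bessel_coef m k * falling (INR n) k) m)%C; [|ring].
  rewrite <- Csum_scal. apply Csum_ext. intros k _.
  destruct (Nat.leb_spec k n) as [Hk|Hk].
  - destruct (Nat.le_exists_sub _ _ Hk) as [d [-> _]].
    replace (d + k - k)%nat with d by lia.
    pose proof (falling_INR_fact k d) as E. rewrite (Nat.add_comm k d) in E. rewrite <- E.
    pose proof (INR_fact_C_neq_0 d) as Hd. pose proof (INR_fact_C_neq_0 (d + k)) as Hdk.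
    rewrite <- E in Hdk.
    assert (Hf : falling (INR (d + k)) k <> 0%C) by (intros E0; apply Hdk; rewrite E0; ring).
    (* As (-1)^(2k) = 1, the parity factor 1 - (-1)^n comes out independent of k, and (n - k)! <n>_k
       = n! turns the rest into the sum of [bessel_coef_falling_sum] at x = n. *)
    replace ((-1) ^ k - (-1) ^ d)%C with ((-1) ^ k * (1 - (-1) ^ (d + k)))%C.
    + field. auto.
    + rewrite Cpow_add_r. transitivity ((-1) ^ k - (-1) ^ d * ((-1) ^ k * (-1) ^ k))%C;
        [ring | rewrite pow_neg_1_sqr; ring].
  - rewrite falling_INR_0 by exact Hk. ring.
Qed.

Definition closed_form (a : C) (m : nat) (z : C) : C :=
  (1 / (2 * (2 * a - 1)) * (1 / odd_dfact (2 * Z.of_nat m - 3)) *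
   Csum (fun k : nat =>
     odd_dfact (2 * Z.of_nat m - 2 * Z.of_nat k - 1) *
     binomial (IZR (2 * Z.of_nat m - Z.of_nat k - 1)) (Z.of_nat k - 1) *
     bracket a k z * Czpow z (Z.of_nat k - 1)) m)%C.

Lemma closed_form_bessel (a : C) m (z : C) :
  closed_form a m z =
  (1 / (2 * (2 * a - 1)) * (1 / odd_dfact (2 * Z.of_nat m - 3)) *
   Csum (fun k => bessel_coef m k * bracket a k z * Czpow z (Z.of_nat k - 1)) m)%C.
Proof.
  unfold closed_form. f_equal. apply Csum_ext. intros k Hk.
  rewrite odd_dfact_binomial_eq_bessel_coef by exact Hk. reflexivity.
Qed.

Lemma Czpow_succ (z : C) k : z <> 0%C -> (z * Czpow z (Z.of_nat k - 1) = z ^ k)%C.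
Proof.
  intros Hz. destruct k as [|[|k]].
  - simpl. field. exact Hz.
  - simpl. reflexivity.
  - replace (Z.of_nat (S (S k)) - 1)%Z with (Z.of_nat (S k)) by lia.
    unfold Z.of_nat, Czpow. rewrite SuccNat2Pos.id_succ. reflexivity.
Qed.

(** Both the bracket and z^(k-1) acquire the sign (-1)^(k+1), so every summand is even. *)
Lemma closed_form_opp (a : C) m (z : C) : z <> 0%C -> closed_form a m (- z) = closed_form a m z.
Proof.
  intros Hz. rewrite !closed_form_bessel. f_equal. apply Csum_ext. intros k _.
  rewrite bracket_opp.
  assert (Hz' : (- z <> 0)%C).
  { intros E. apply Hz. replace z with (- - z)%C by ring. rewrite E. ring. }
  assert (E : Czpow (- z) (Z.of_nat k - 1) = ((-1) ^ S k * Czpow z (Z.of_nat k - 1))%C).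
  { pose proof (Czpow_succ z k Hz) as E1. pose proof (Czpow_succ (- z) k Hz') as E2.
    replace (Czpow (- z) (Z.of_nat k - 1)) with ((- z) ^ k / (- z))%C by (rewrite <- E2; field; exact Hz).
    replace (- z)%C with (-1 * z)%C at 1 by ring. rewrite Cpow_mult_l, <- E1. cbn [Cpow].
    field. exact Hz. }
  rewrite E. transitivity (bessel_coef m k * bracket a k z * Czpow z (Z.of_nat k - 1) *
    ((-1) ^ S k * (-1) ^ S k))%C; [ring | rewrite pow_neg_1_sqr; ring].
Qed.

(** Only k = 1 survives: the coefficient at k = 0 is 0 when the upper limit is positive, which
    discards the meaningless z^(-1), and k >= 2 carries a positive power of 0. *)
Lemma closed_form_at_0 (a : C) m : a <> (1 / 2)%C -> closed_form a (S m) 0 = 1%C.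
Proof.
  intros Ha. rewrite closed_form_bessel.
  assert (E : forall n, Csum (fun k => bessel_coef (S m) k * bracket a k 0 * Czpow 0 (Z.of_nat k - 1))%C (S n)
    = (bessel_coef (S m) 1 * bracket a 1 0)%C).
  { induction n as [|n IH].
    - rewrite Csum_S, Csum_0. simpl (bessel_coef (S m) 0). simpl (Czpow 0 (Z.of_nat 1 - 1)). ring.
    - rewrite Csum_S, IH. replace (Z.of_nat (S (S n)) - 1)%Z with (Z.of_nat (S n)) by lia.
      simpl (Czpow 0 (Z.of_nat (S n))). rewrite SuccNat2Pos.id_succ. cbn [Cpow]. ring. }
  rewrite E, <- (odd_dfact_binomial_eq_bessel_coef (S m) 1) by lia.
  replace (2 * Z.of_nat (S m) - 2 * Z.of_nat 1 - 1)%Z with (2 * Z.of_nat (S m) - 3)%Z by lia.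
  assert (Eb : binomial (IZR (2 * Z.of_nat (S m) - Z.of_nat 1 - 1)) (Z.of_nat 1 - 1) = 1%C).
  { unfold binomial. simpl (Z.of_nat 1 - 1)%Z. simpl (0 <=? 0)%Z. cbn iota. simpl. field. }
  assert (Ec : bracket a 1 0 = (2 * (2 * a - 1))%C).
  { unfold bracket. rewrite Cplus_0_r. replace (1 - 0)%C with (RtoC 1) by ring.
    assert (E1 : Ccpow 1 (1 - 2 * a - INR 1) = 1%C).
    { rewrite Ccpow_neq_0 by exact C1_nz. rewrite Clog_1, Cmult_0_r. apply Cexp_0. }
    rewrite E1. cbn [rising falling]. simpl (INR 0). ring. }
  rewrite Eb, Ec.
  assert (Ha' : (2 * a - 1 <> 0)%C).
  { intros E'. apply Ha. transitivity ((2 * a - 1) / 2 + 1 / 2)%C; [field|]. rewrite E'. field. }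
  pose proof (RtoC_neq_0 _ (odd_dfact_neq_0 (S m))) as Hdf. field. auto.
Qed.

Lemma is_pseries_C_at_0 (u : nat -> C) : @is_pseries C_AbsRing C_NormedModule u (RtoC 0) (u 0%nat).
Proof.
  apply is_pseries_C. intros eps He. exists 0%nat. intros n _.
  replace (Csum _ n) with (u 0%nat).
  - replace (u 0%nat - u 0%nat)%C with (RtoC 0) by ring. rewrite Cmod_0. exact He.
  - induction n as [|n IH]; [rewrite Csum_0; simpl; ring|].
    rewrite Csum_S, <- IH. simpl. ring.
Qed.

Lemma hyp2F1_coef_0 (a b c : C) : hyp2F1_coef a b c 0 = 1%C.
Proof. unfold hyp2F1_coef. simpl. field. Qed.

Lemma closed_form_series (a z : C) m :
  a <> (1 / 2)%C -> (m = 0%nat -> z <> 0%C) ->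
  Cmod z < 1 \/ (exists q : nat, (1 - 2 * a)%C = INR q) ->
  @is_pseries C_AbsRing C_NormedModule
    (hyp2F1_coef a (a + 1 / 2) (3 / 2 - INR m)) (z ^ 2)%C (closed_form a m z).
Proof.
  intros Ha Hm H. destruct (Ceq_dec z 0) as [->|Hz].
  - destruct m as [|m]; [exfalso; apply Hm; reflexivity|].
    rewrite closed_form_at_0 by exact Ha. replace (0 ^ 2)%C with (RtoC 0) by (simpl; ring).
    pose proof (is_pseries_C_at_0 (hyp2F1_coef a (a + 1 / 2) (3 / 2 - INR (S m)))) as E.
    rewrite hyp2F1_coef_0 in E. exact E.
  - pose proof (bracket_sum_series a z m H) as E.
    set (kappa := (1 / (2 * (2 * a - 1)) * (1 / odd_dfact (2 * Z.of_nat m - 3)))%C).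
    apply (is_pseries_C_scal kappa) in E.
    replace (kappa * Csum _ m)%C with (z * closed_form a m z)%C in E.
    + apply is_pseries_C_odd in E; [|exact Hz|].
      * apply is_pseries_C_ext with (2 := E). intros j.
        rewrite <- odd_coef_eq_hyp2F1_coef by exact Ha. fold kappa.
        rewrite plus_INR, mult_INR, RtoC_plus, RtoC_mult. change (INR 2) with 2. change (INR 1) with 1.
        replace (1 - (-1) ^ (2 * j + 1))%C with (RtoC 2); [unfold Cdiv; ring|].
        rewrite Cpow_add_r, Cpow_mult_r. replace ((-1) ^ 2)%C with (RtoC 1) by (simpl; ring).
        rewrite Cpow_1_l. simpl. ring.
      * intros j. rewrite Cpow_mult_r. replace ((-1) ^ 2)%C with (RtoC 1) by (simpl; ring).
        rewrite Cpow_1_l. ring.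
    + rewrite closed_form_bessel. fold kappa.
      transitivity (kappa * (z * Csum (fun k => bessel_coef m k * bracket a k z * Czpow z (Z.of_nat k - 1)) m))%C;
        [ring|].
      f_equal. rewrite <- Csum_scal. apply Csum_ext. intros k _.
      rewrite <- (Czpow_succ z k Hz). ring.
Qed.

Lemma terminating_exponent (a : C) :
  nonpos_int a \/ nonpos_int (a + 1 / 2)%C -> exists q : nat, (1 - 2 * a)%C = INR q.
Proof.
  intros [[n Hn]|[n Hn]].
  - exists (2 * n + 1)%nat. rewrite Hn, plus_INR, mult_INR, RtoC_opp, RtoC_plus, RtoC_mult.
    change (INR 2) with 2. change (INR 1) with 1. ring.
  - exists (2 * n + 2)%nat. replace (1 - 2 * a)%C with (2 - 2 * (a + 1 / 2))%C by field.
    rewrite Hn, plus_INR, mult_INR, RtoC_opp, RtoC_plus, RtoC_mult.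
    change (INR 2) with 2. ring.
Qed.

(** * The closed form as an analytic function of x = z^2 *)

Lemma analytic_at_ext_loc (F G : C -> C) (x : C) (r : R) :
  0 < r -> (forall y, Cmod (y - x) < r -> F y = G y) -> analytic_at F x -> analytic_at G x.
Proof.
  intros Hr HE [u [r' [Hr' Hu]]]. exists u, (Rmin r r'). split; [apply Rmin_pos; assumption|].
  intros y Hy. pose proof (Rmin_l r r'). pose proof (Rmin_r r r').
  rewrite <- HE by lra. apply Hu. lra.
Qed.

Lemma analytic_at_scal (c : C) (F : C -> C) (x : C) :
  analytic_at F x -> analytic_at (fun y => c * F y)%C x.
Proof.
  intros [u [r [Hr Hu]]]. exists (fun n => c * u n)%C, r. split; [exact Hr|].
  intros y Hy. apply is_pseries_C_scal, Hu, Hy.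
Qed.

Lemma analytic_at_Csum (F : nat -> C -> C) (x : C) m :
  (forall k, (k <= m)%nat -> analytic_at (F k) x) ->
  analytic_at (fun y => Csum (fun k => F k y) m) x.
Proof.
  induction m as [|m IH]; intros H.
  - apply analytic_at_ext_loc with (F := F 0%nat) (r := 1); [lra | | apply H; lia].
    intros y _. rewrite Csum_0. reflexivity.
  - apply analytic_at_ext_loc with (r := 1)
      (F := fun y => (Csum (fun k => F k y) m - -1 * F (S m) y)%C); [lra | |].
    + intros y _. rewrite Csum_S. ring.
    + apply analytic_at_minus; [apply IH; intros; apply H; lia | apply analytic_at_scal, H; lia].
Qed.

(** Merely selects some root globally; its jump on the negative axis disappears because the closed
    form is even. *)
Definition principal_sqrt (x : C) : C := Cexp (/ 2 * Clog x).

Lemma principal_sqrt_sqr (x : C) : x <> 0%C -> (principal_sqrt x ^ 2)%C = x.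
Proof.
  intros Hx. unfold principal_sqrt. simpl. rewrite Cmult_1_r, <- Cexp_plus.
  replace (/ 2 * Clog x + / 2 * Clog x)%C with (Clog x) by field. apply Cexp_Clog, Hx.
Qed.

(* The value at [0] is set by hand because [closed_form a 0 0] is a junk [0 * / 0]. *)
Definition closed_form_sqrt (a : C) (m : nat) (x : C) : C :=
  if Ceq_dec x 0 then RtoC 1 else closed_form a m (principal_sqrt x).

(** Two square roots of x differ at most by sign. This allows the local branch of the root to
    replace the principal one. *)
Lemma closed_form_sqrt_sqr (a : C) m (x s : C) : x <> 0%C -> (s ^ 2)%C = x ->
  closed_form_sqrt a m x = closed_form a m s.
Proof.
  intros Hx Hs. unfold closed_form_sqrt. destruct (Ceq_dec x 0) as [E|_]; [contradiction|].
  pose proof (principal_sqrt_sqr x Hx) as Hr. set (r := principal_sqrt x) in *.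
  assert (E : ((r - s) * (r + s) = 0)%C).
  { transitivity (r ^ 2 - s ^ 2)%C; [simpl; ring | rewrite Hr, Hs; ring]. }
  destruct (Ceq_dec r s) as [->|Hne]; [reflexivity|].
  assert (Hs0 : s <> 0%C) by (intros ->; apply Hx; rewrite <- Hs; simpl; ring).
  destruct (Ceq_dec (r + s) 0) as [E1|E1].
  - replace r with (- s)%C; [apply closed_form_opp, Hs0|].
    transitivity (- s + (r + s))%C; [rewrite E1; ring | ring].
  - exfalso. revert E. apply Cmult_neq_0; [apply Cminus_eq_contra, Hne | exact E1].
Qed.

Lemma closed_form_sqrt_series (a : C) m (x : C) : a <> (1 / 2)%C ->
  Cmod x < 1 \/ nonpos_int a \/ nonpos_int (a + 1 / 2)%C ->
  @is_pseries C_AbsRing C_NormedModule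
    (hyp2F1_coef a (a + 1 / 2) (3 / 2 - INR m)) x (closed_form_sqrt a m x).
Proof.
  intros Ha H. destruct (Ceq_dec x 0) as [->|Hx].
  - unfold closed_form_sqrt. destruct (Ceq_dec 0 0) as [_|]; [|congruence].
    pose proof (is_pseries_C_at_0 (hyp2F1_coef a (a + 1 / 2) (3 / 2 - INR m))) as E.
    rewrite hyp2F1_coef_0 in E. exact E.
  - pose proof (principal_sqrt_sqr x Hx) as Hs.
    rewrite (closed_form_sqrt_sqr a m x _ Hx Hs). rewrite <- Hs at 1.
    apply closed_form_series; [exact Ha | |].
    + intros _ E. apply Hx. rewrite <- Hs, E. simpl; ring.
    + destruct H as [H|H]; [left | right; apply terminating_exponent, H].
      rewrite <- Hs, Cmod_pow in H. pose proof (Cmod_ge_0 (principal_sqrt x)). simpl in H. nra.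
Qed.

Lemma Czpow_Cexp (w : C) k : Czpow (Cexp w) (Z.of_nat k - 1) = Cexp ((INR k - 1) * w).
Proof.
  pose proof (Cexp_neq_0 w) as H0. pose proof (Czpow_succ (Cexp w) k H0) as E.
  assert (E2 : (Cexp w ^ k)%C = Cexp (INR k * w)).
  { clear. induction k as [|k IH].
    - simpl. rewrite Cmult_0_l, Cexp_0. reflexivity.
    - cbn [Cpow]. rewrite IH, <- Cexp_plus, S_INR, RtoC_plus. f_equal. ring. }
  replace ((INR k - 1) * w)%C with (INR k * w + - w)%C by ring.
  rewrite Cexp_plus, Cexp_opp, <- E2, <- E. field. exact H0.
Qed.

Lemma closed_form_sqrt_analytic (a : C) m (x : C) : a <> (1 / 2)%C ->
  slit_plane x -> analytic_at (closed_form_sqrt a m) x.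
Proof.
  intros Ha Hx. destruct (Ceq_dec x 0) as [->|Hx0].
  - exists (hyp2F1_coef a (a + 1 / 2) (3 / 2 - INR m)), 1. split; [lra|]. intros y Hy.
    replace (y - 0)%C with y in * by ring. apply closed_form_sqrt_series; auto.
  - destruct (slit_plane_open x Hx) as [r [Hr Hslit]].
    assert (Hm : 0 < Cmod x) by (apply Cmod_gt_0, Hx0).
    set (L := local_log_sqrt x). set (kappa := (1 / (2 * (2 * a - 1)) * (1 / odd_dfact (2 * Z.of_nat m - 3)))%C).
    (* The radius keeps y in the slit plane and off 0. The two functions with e = 1 and e = -1 are
       the two powers in the bracket, each multiplied by s^(k-1). *)
    apply analytic_at_ext_loc with (r := Rmin r (Cmod x)) (F := fun y =>
      (kappa * Csum (fun k => bessel_coef m k * rising (2 * a - 1) k *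
                       branch_fun 1 L (1 - 2 * a - INR k) (INR k - 1) y
                     - bessel_coef m k * falling (1 - 2 * a) k *
                       branch_fun (-1) L (1 - 2 * a - INR k) (INR k - 1) y) m)%C).
    + apply Rmin_pos; assumption.
    + intros y Hy. pose proof (Rmin_l r (Cmod x)). pose proof (Rmin_r r (Cmod x)).
      assert (Hy0 : y <> 0%C).
      { intros ->. replace (0 - x)%C with (- x)%C in Hy by ring. rewrite Cmod_opp in Hy. lra. }
      pose proof (Cexp_local_log_sqrt x y Hx0 Hy0) as Hs. fold L in Hs.
      rewrite (closed_form_sqrt_sqr a m y _ Hy0 Hs), closed_form_bessel. fold kappa. f_equal.
      apply Csum_ext. intros k _. rewrite Czpow_Cexp. unfold bracket, branch_fun.
      assert (Hc1 : (1 + Cexp (L y) <> 0)%C).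
      { apply cut_plane_neq_0, cut_plane_one_plus_sqrt. rewrite Hs. apply Hslit; lra. }
      assert (Hc2 : (1 - Cexp (L y) <> 0)%C).
      { apply cut_plane_neq_0, cut_plane_one_plus_sqrt.
        replace ((- Cexp (L y)) ^ 2)%C with (Cexp (L y) ^ 2)%C by (simpl; ring).
        rewrite Hs. apply Hslit; lra. }
      rewrite (Ccpow_neq_0 _ _ Hc1), (Ccpow_neq_0 _ _ Hc2).
      replace (1 + -1 * Cexp (L y))%C with (1 - Cexp (L y))%C by ring.
      rewrite Cmult_1_l, !Cexp_plus. ring.
    + apply analytic_at_scal, analytic_at_Csum. intros k _.
      apply analytic_at_minus; apply analytic_at_scal, branch_fun_analytic; auto; ring.
Qed.

(** [ha] keeps the prefactor finite. [hz0] excludes the removable singularity at z = 0, present only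
    for m = 0, where the single summand contains z^(-1). *)
Theorem theorem2p3 (a : C) (m : nat) (z : C)
  (ha : a <> (1 / 2)%C)
  (hz0 : m = 0%nat -> z <> 0%C)
  (hz : hyp2F1_dom a (a + 1 / 2)%C (z ^ 2)%C) :
  hyp2F1 a (a + 1 / 2)%C (3 / 2 - INR m)%C (z ^ 2)%C =
  (1 / (2 * (2 * a - 1)) * (1 / odd_dfact (2 * Z.of_nat m - 3)) *
   @sum_n C_AbelianMonoid (fun k : nat =>
     odd_dfact (2 * Z.of_nat m - 2 * Z.of_nat k - 1) *
     binomial (IZR (2 * Z.of_nat m - Z.of_nat k - 1)) (Z.of_nat k - 1) *
     (rising (2 * a - 1) k * Ccpow (1 + z) (1 - 2 * a - INR k) -
      falling (1 - 2 * a) k * Ccpow (1 - z) (1 - 2 * a - INR k)) *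
     Czpow z (Z.of_nat k - 1)) m)%C.
Proof.
  change (hyp2F1 a (a + 1 / 2)%C (3 / 2 - INR m)%C (z ^ 2)%C = closed_form a m z).
  assert (HG : is_hyp2F1 a (a + 1 / 2)%C (3 / 2 - INR m)%C (closed_form_sqrt a m)).
  { split; intros x Hx; [apply closed_form_sqrt_series | apply closed_form_sqrt_analytic]; auto. }
  assert (HF : is_hyp2F1 a (a + 1 / 2)%C (3 / 2 - INR m)%C
                 (hyp2F1 a (a + 1 / 2)%C (3 / 2 - INR m)%C)).
  (* The closed form supplies the existence on which the choice in [hyp2F1] depends. *)
  { unfold hyp2F1. apply epsilon_spec. exists (closed_form_sqrt a m). exact HG. }
  destruct HF as [HFs HFa].
  destruct HG as [HGs HGa].
  destruct hz as [Hslit|Hterm].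
  - assert (Hdisc : forall x, Cmod x < 1 ->
      hyp2F1 a (a + 1 / 2)%C (3 / 2 - INR m)%C x = closed_form_sqrt a m x).
    { intros x Hx. eapply is_pseries_C_unique; [apply HFs | apply HGs]; auto. }
    rewrite (analytic_identity_slit_plane _ _ HFa HGa Hdisc _ Hslit).
    destruct (Ceq_dec z 0) as [E|Hz].
    + subst z. destruct m as [|m]; [exfalso; apply hz0; reflexivity|].
      rewrite closed_form_at_0 by exact ha. unfold closed_form_sqrt.
      destruct (Ceq_dec (0 ^ 2) 0) as [_|n]; [reflexivity|]. exfalso; apply n; simpl; ring.
    + apply closed_form_sqrt_sqr; [apply Cpow_nz, Hz | reflexivity].
  (* Here z^2 may lie on the slit, out of reach of the identity theorem; both sides are sums of the
     same terminating series at this point. *)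
  - eapply is_pseries_C_unique; [apply HFs; right; exact Hterm|].
    apply closed_form_series; auto. right. apply terminating_exponent, Hterm.
Qed.
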